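(* Let $L$ be a linear network which is a tree, with vertex set $V$ and geodesic metric $d$. Let $s>0$ and $\sigma>0$ be parameters, and let $u_0\in V$ be an arbitrary vertex. Let $G_0(u_0)=\{u_0\}$, and for $j=1,2,\ldots$ let $G_j(u_0)$ be the set of children of $j$-th generation to $u_0$ (defined in the context). Construct random variables $Y(w)$ for all $w\in L$ as follows. (I) Generate $Y(u_0)$ from the normal distribution $N(0,\sigma^2)$. (II) For $j=1,2,\ldots$, conditioned on all the $Y(w)$ so far generated, generate independent Gaussian processes $Y(u,v)=\{Y(w): w\in(u,v]\}$ for all $u\in G_{j-1}(u_0)$ and all $v\in G_j(u_0)$ with $u\sim v$, where the conditional distribution of $Y(u,v)$ depends only on $Y(u)$ and, for every $w,w_1,w_2\in(u,v]$, $$\mathbb E[Y(w)\mid Y(u)]=\exp(-\|w-u\|s)\,Y(u),$$ $$\mathrm{Cov}[Y(w_1),Y(w_2)\mid Y(u)]=\sigma^2\left(\exp(-\|w_1-w_2\|s)-\exp(-\|w_1-u\|s-\|w_2-u\|s)\right).$$ (III) Output $Y=\{Y(w): w=u_0\text{ or } w\in(u,v]\text{ for some } j\in\mathbb N,\ u\in G_{j-1}(u_0),\ v\in G_j(u_0)\text{ with }u\sim v\}$. Then $Y$ is a zero mean Gaussian process on $L$ with exponential covariance function $c(u,v)=\sigma^2\exp(-s\,d(u,v))$, $u,v\in L$.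
   Context: Linear network: $L=\bigcup_{i=1}^m L_i$ with $m<\infty$, where each $L_i\subset\mathbb R^k$ is a closed line segment of length $l_i\in(0,\infty)$ with endpoints $a_i,b_i$, $L_i\cap L_j$ is either empty or an endpoint of both $L_i$ and $L_j$ whenever $i\neq j$, and $L$ is path-connected. $\|\cdot\|$ is the Euclidean norm. $V$ is the set of endpoints of $L_1,\ldots,L_m$; for distinct $u,v\in V$, $u\sim v$ means that $\{u,v\}=\{a_j,b_j\}$ for some $j$. $L$ is a tree if the graph $(V,\sim)$ contains no loop (cycle). The geodesic metric $d(u,v)=d_{\mathcal G}(u,v)$ on $L$ is the minimum length (arc length measure) of a path in $L$ connecting $u$ and $v$; on a tree it coincides with the so-called resistance metric $d_{\mathcal R}$. Generations: $G_0(u_0)=\{u_0\}$, and for $j=1,2,\ldots$, a vertex $u\in V\setminus\bigcup_{i=0}^{j-1}G_i(u_0)$ is called a child of $j$-th generation to $u_0$ if $u\sim v$ for some $v\in G_{j-1}(u_0)$; $G_j(u_0)\subset V$ is the set of all such children. For $u\sim v$, $(u,v]$ denotes the half-open line segment with endpoints $u$ and $v$, with $u$ excluded and $v$ included. A Gaussian process on $L$ is a real-valued stochastic process indexed by $L$ whose finite-dimensional distributions are all multivariate normal (possibly degenerate). *)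

(* Defs.v *)
From HB Require Import structures.
From mathcomp Require Import all_boot all_order all_algebra.
From mathcomp Require Import all_classical all_reals all_analysis.

Set Implicit Arguments.
Unset Strict Implicit.
Unset Printing Implicit Defensive.

Import Order.TTheory GRing.Theory Num.Theory.
Import numFieldNormedType.Exports.

Local Open Scope classical_set_scope.
Local Open Scope ring_scope.

Section Geometry.
Context {R : realType} {k : nat}.
Implicit Types (u v w x : 'rV[R]_k) (L : set 'rV[R]_k).

(* The library norm on 'rV[R]_k is the sup norm, hence a separate definition;
   the two norms induce the same topology, so continuity is the library's. *)
Definition enorm x : R := Num.sqrt (\sum_(i < k) x ord0 i ^+ 2).

Definition segment u v : set 'rV[R]_k :=
  [set (1 - t) *: u + t *: v | t in `[0, 1]].

Definition half_open_segment u v : set 'rV[R]_k :=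
  [set (1 - t) *: u + t *: v | t in `]0, 1]].

Definition path_in L u v : set (R -> 'rV[R]_k) :=
  [set g : R -> 'rV[R]_k |
    [/\ {within `[0 : R, 1], continuous g}, g 0 = u, g 1 = v &
        forall t, t \in `[0, 1] -> L (g t)]].

(* Length of g on [0, 1]: Euclidean counterpart of the library's
   [total_variation], which is restricted to real-valued functions. *)
Definition path_length (g : R -> 'rV[R]_k) : \bar R :=
  ereal_sup [set (let G := g \o nth 1 (0 :: p) in
                  \sum_(0 <= n < size p) enorm (G n.+1 - G n))%:E
            | p in itv_partition (0 : R) 1].

(* The infimum is attained, and finite, between points of a linear network. *)
Definition geodesic L u v : R :=
  fine (ereal_inf [set path_length g | g in path_in L u v]).

Definition path_connected L : Prop :=
  forall u v, L u -> L v -> path_in L u v !=set0.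

End Geometry.

Section LinearNetwork.
Context {R : realType} {k m : nat} (a b : 'I_m -> 'rV[R]_k).
Implicit Types (u v w : 'rV[R]_k).

Definition network : set 'rV[R]_k := \bigcup_i segment (a i) (b i).

Definition endpoint (i : 'I_m) : set 'rV[R]_k := [set a i; b i].

Record linear_network : Prop := LinearNetwork {
  segment_nontrivial : forall i, a i != b i;
  segment_meet : forall i j, i != j ->
    segment (a i) (b i) `&` segment (a j) (b j) = set0 \/
    exists v, [/\ endpoint i v, endpoint j v &
                 segment (a i) (b i) `&` segment (a j) (b j) = [set v]];
  network_connected : path_connected network }.

Definition vertices : set 'rV[R]_k := \bigcup_i endpoint i.

Definition adj : rel 'rV[R]_k := fun u v =>
  (u != v) &&
  [exists j, ((u == a j) && (v == b j)) || ((u == b j) && (v == a j))].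

Definition is_tree : Prop :=
  forall c : seq 'rV[R]_k, (2 < size c)%N -> ~ ucycle adj c.

(* The pair of the j-th generation and the union of generations 0, ..., j;
   see [generationS] for the defining recurrence. *)
Fixpoint generation_and_union (u0 : 'rV[R]_k) (j : nat) :
    set 'rV[R]_k * set 'rV[R]_k :=
  if j is i.+1 then
    let: (G, U) := generation_and_union u0 i in
    let G' := [set u | [/\ vertices u, ~ U u & exists2 v, G v & adj u v]] in
    (G', U `|` G')
  else ([set u0], [set u0]).

Definition generation u0 j : set 'rV[R]_k := (generation_and_union u0 j).1.

Lemma generation0 u0 : generation u0 0 = [set u0].
Proof. by []. Qed.

Lemma generationS u0 j : generation u0 j.+1 =
  [set u | [/\ vertices u, ~ (\bigcup_(i in `I_j.+1) generation u0 i) u &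
              exists2 v, generation u0 j v & adj u v]].
Proof.
have gU n :
    (generation_and_union u0 n).2 = \bigcup_(i in `I_n.+1) generation u0 i.
  elim: n => [|n IH]; first by rewrite bigcup_mkord big_ord1.
  rewrite bigcup_mkord big_ord_recr/= -bigcup_mkord -IH /generation /=.
  by case: (generation_and_union u0 n).
rewrite -gU /generation /=.
by case: (generation_and_union u0 j).
Qed.

(* The pairs (u, v) treated at the (j+1)-th iteration. *)
Definition new_edges u0 j : set ('rV[R]_k * 'rV[R]_k) :=
  [set e | [/\ generation u0 j e.1, generation u0 j.+1 e.2 & adj e.1 e.2]].

(* The points w for which Y(w) has been generated after j iterations. *)
Definition generated u0 j : set 'rV[R]_k :=
  u0 |` \bigcup_(i in `I_j) \bigcup_(e in new_edges u0 i)
          half_open_segment e.1 e.2.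

Definition output u0 : set 'rV[R]_k := \bigcup_j generated u0 j.

End LinearNetwork.

Section Conditioning.
Context {d} {Omega : measurableType d} {R : realType} (P : probability Omega R).
Implicit Types (F : set (set Omega)).

(* Z is a version of E[X | F], for a sub-sigma-algebra F. *)
Definition is_condexp F (X Z : Omega -> R) : Prop :=
  [/\ forall B : set R, measurable B -> F (Z @^-1` B),
      P.-integrable setT (EFin \o Z) &
      forall A, F A ->
        (\int[P]_(x in A) (Z x)%:E = \int[P]_(x in A) (X x)%:E)%E].

Definition is_condprob F (E : set Omega) (p : Omega -> R) : Prop :=
  is_condexp F \1_E p.

(* K is a (regular) conditional distribution of X given F. *)
Definition is_conddist F d' (T : measurableType d') (X : Omega -> T)
    (K : Omega -> probability T R) : Prop :=
  forall B, measurable B ->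
    is_condprob F (X @^-1` B) (fun omega => fine (K omega B)).

(* Independence given F of the sigma-algebras H i, i in D. *)
Definition cond_independent F (I : choiceType) (D : set I)
    (H : I -> set (set Omega)) : Prop :=
  forall s : seq I, uniq s -> (forall i, i \in s -> D i) ->
  forall (E : I -> set Omega) (p : I -> Omega -> R),
    (forall i, i \in s -> H i (E i) /\ is_condprob F (E i) (p i)) ->
    is_condprob F (\bigcap_(i in [set` s]) E i)
      (fun omega => \prod_(i <- s) p i omega).

(* The sigma-algebra generated by the variables Y w, w in D. *)
Definition process_sigma (T : Type) (Y : T -> Omega -> R) (D : set T) :
    set (set Omega) :=
  <<s \bigcup_(w in D) preimage_set_system setT (Y w) measurable >>.

Definition marginal (T : Type) (Y : T -> Omega -> R) n (w : n.-tuple T) :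
    Omega -> n.-tuple R :=
  fun omega => [tuple Y (tnth w i) omega | i < n].

End Conditioning.

Section Gaussian.
Context {R : realType}.

(* N(mu, tau^2), including the degenerate case tau = 0, for which
   [normal_prob] is the uniform distribution on [0, 1]. *)
Definition gauss (mu tau : R) : set R -> \bar R :=
  if tau == 0 then \d_mu else normal_prob mu tau.

(* Possibly degenerate: every linear form is normally distributed. *)
Definition multivariate_normal n (M : set (n.-tuple R) -> \bar R) : Prop :=
  forall c : 'I_n -> R, exists mu tau : R, forall B : set R, measurable B ->
    pushforward M (fun x : n.-tuple R => \sum_(i < n) c i * tnth x i) B =
    gauss mu tau B.

Definition gaussian_process d (Omega : measurableType d)
    (P : probability Omega R) (T : Type) (D : set T) (Y : T -> Omega -> R) :
    Prop :=
  forall n (w : n.-tuple T), (forall i, D (tnth w i)) ->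
    multivariate_normal (pushforward P (marginal Y w)).

End Gaussian.

(* Main.v *)
(* A process is centred Gaussian with covariance c as soon as every linear form
   sum q.1 * Y q.2 has law N(0, sum sum q.1 r.1 c(q.2, r.2)); this is propagated
   along the construction, one edge at a time.

   For an edge (u, v] of the current generation, the conditional law of a linear
   form Z on (u, v] is normal with mean beta Y(u) and a deterministic variance
   tau^2, so Z - beta Y(u) has law N(0, tau^2) and is independent of the past.
   By conditional independence it is also independent of the edges of the same
   generation that were treated before. Hence a form on the enlarged set is a
   form on the old set plus an independent normal residual, and is normal.

   The variances match because removing u disconnects (u, v] from the points
   already treated (every edge of a tree is a bridge, and two segments meet only
   in common endpoints): every path from x in (u, v] to such a point y passes
   through u, and d(x, y) = |x - u| + d(u, y). *)
Require Import Defs.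
From HB Require Import structures.
From mathcomp Require Import all_boot all_order all_algebra.
From mathcomp Require Import all_classical all_reals all_analysis.
From mathcomp Require Import measurable_realfun.
From mathcomp Require Import ring lra.
Set Implicit Arguments.
Unset Strict Implicit.
Unset Printing Implicit Defensive.
Import Order.TTheory GRing.Theory Num.Theory.
Import numFieldNormedType.Exports.
Local Open Scope classical_set_scope.
Local Open Scope ring_scope.

(** * Integrals and normal laws *)

(** The law on an edge comes as a kernel whose forms are normal with unspecified parameters; only
    its mean and covariance are prescribed. The parameters must therefore be read off from the first
    two moments of a normal law, and these follow from [exp t >= 1 + t].

    Conditional independence speaks of events of single edges, whereas a residual mixes an edge with
    [Y e.1]. Independence is therefore tested first on cylinders, each an event of the past
    intersected with one event per edge already treated. They form a pi-system whose sigma-algebra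
    makes the forms concerned measurable.

    Positive definiteness of the exponential kernel on a tree is not shown separately: the quadratic
    form appears as the square of a standard deviation throughout the induction.

    In the geometry, paths are arbitrary continuous maps and [geodesic] is the real part of an
    infimum. Separation thus rests on the connectedness of [0, 1], and adding distances requires a
    proof that they are finite. *)

Section Density.
Context d (T : measurableType d) (R : realType).
Import HBNNSimple.
Variables (mu m : {measure set T -> \bar R}) (p : T -> R).
Hypotheses (mp : measurable_fun setT p) (p0 : forall x, 0 <= p x).
Hypothesis mE : forall A, measurable A -> m A = (\int[mu]_(x in A) (p x)%:E)%E.
Local Open Scope ereal_scope.

(** Monotone convergence reduces the claim to simple functions, where it is [mE]. It serves twice:
    for normal laws, and over a sub-sigma-algebra to take a factor out of a conditional
    probability. *)
Lemma ge0_integral_density (f : T -> \bar R) : measurable_fun setT f ->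
  (forall x, 0 <= f x) -> \int[m]_x f x = \int[mu]_x (f x * (p x)%:E).
Proof.
move=> mf f0; pose f_ := nnsfun_approx measurableT mf.
have mpE : measurable_fun setT (EFin \o p) by exact/measurable_EFinP.
transitivity (limn (fun n => \int[m]_x (f_ n x)%:E)).
  rewrite -monotone_convergence//.
  - apply: eq_integral => y _; apply/esym/cvg_lim => //.
    exact: cvg_nnsfun_approx.
  - by move=> n; exact/measurable_EFinP/measurable_funP.
  - by move=> n y _; rewrite lee_fin.
  - by move=> y _ i n ni; rewrite lee_fin; exact/lefP/nd_nnsfun_approx.
transitivity (limn (fun n => \int[mu]_x ((f_ n x)%:E * (p x)%:E))); last first.
  rewrite -monotone_convergence//.
  - apply: eq_integral => y _; apply/cvg_lim => //.
    by apply: cvgeZr => //; exact: cvg_nnsfun_approx.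
  - by move=> n; apply: emeasurable_funM => //; exact/measurable_EFinP/measurable_funP.
  - by move=> n y _; rewrite mule_ge0// lee_fin.
  - move=> y _ i n ni; apply: lee_wpmul2r; rewrite lee_fin//.
    exact/lefP/nd_nnsfun_approx.
congr (limn _); apply/funext => n.
have mf_ k : measurable (f_ n @^-1` [set k]) by exact: measurable_sfunP.
transitivity (\sum_(k \in range (f_ n))
    \int[m]_x (k * \1_(f_ n @^-1` [set k]) x)%:E).
  under eq_integral do rewrite fimfunE -fsumEFin//.
  rewrite ge0_integral_fsum//.
  - by move=> y; exact/measurable_EFinP/measurable_funM.
  - by move=> y x _; rewrite nnfun_muleindic_ge0.
transitivity (\sum_(k \in range (f_ n))
    \int[mu]_x ((k * \1_(f_ n @^-1` [set k]) x)%:E * (p x)%:E)); last first.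
  rewrite -ge0_integral_fsum//.
  - apply: eq_integral => x _; rewrite [in RHS]fimfunE -fsumEFin// ge0_mule_fsuml//.
    by move=> i; rewrite nnfun_muleindic_ge0.
  - move=> y; apply: emeasurable_funM => //.
    exact/measurable_EFinP/measurable_funM.
  - by move=> y x _; rewrite mule_ge0 ?lee_fin// -lee_fin nnfun_muleindic_ge0.
apply: eq_fsbigr => k _.
have [k0|k0] := ltP k 0%R.
  rewrite (preimage_nnfun0 _ k0) !integral0_eq// => x _.
    by rewrite indic0 mulr0 mul0e.
  by rewrite indic0 mulr0.
under eq_integral do rewrite EFinM.
rewrite ge0_integralZl_EFin//; last exact/measurable_EFinP.
rewrite integral_indic// setIT mE//.
under [RHS]eq_integral do rewrite EFinM -muleA.
rewrite ge0_integralZl_EFin//.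
- congr (_ * _); rewrite [LHS]integral_mkcond; apply: eq_integral => x _.
  by rewrite epatch_indic muleC.
- by move=> x _; rewrite mule_ge0 ?lee_fin.
- by apply: emeasurable_funM => //; exact/measurable_EFinP.
Qed.


End Density.

Section Translation.
Context {R : realType}.
Local Notation mu := (@lebesgue_measure R).

Lemma lebesgue_measure_translate (c : R) (A : set R) : measurable A ->
  pushforward mu (fun x : measurableTypeR R => x + c : measurableTypeR R) A = mu A.
Proof.
move=> mA.
have mc : measurable_fun setT (fun x : measurableTypeR R => x + c : measurableTypeR R).
  exact: measurable_funD.
pose T : {mfun (measurableTypeR R) >-> (measurableTypeR R)} :=
  HB.pack (fun x : measurableTypeR R => x + c : measurableTypeR R)
    (isMeasurableFun.Build _ _ _ _ _ mc).
rewrite -[LHS]/(pushforward mu T A).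
apply/esym/lebesgue_measure_unique => //= _ [[a b]] _ <-.
rewrite /pushforward/=.
rewrite (_ : _ @^-1` _ = `](a - c)%R, (b - c)%R]%classic).
  rewrite !lebesgue_measure_itv/= !lte_fin ltrD2r; case: ifP => // _.
  by rewrite -!EFinD; congr (_%:E); ring.
by apply/seteqP; split => x /=; rewrite !in_itv/= ltrBlDr lerBrDr.
Qed.

Lemma ge0_integral_translate (f : R -> \bar R) (c : R) (B : set R) :
  measurable B -> measurable_fun setT f -> (forall x, (0 <= f x)%E) ->
  (\int[mu]_(x in (fun x => (x + c)%R) @^-1` B) f (x + c)%R = \int[mu]_(x in B) f x)%E.
Proof.
move=> mB mf f0.
have mc : measurable_fun setT (fun x : measurableTypeR R => x + c : measurableTypeR R).
  exact: measurable_funD.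
rewrite -(@ge0_integral_pushforward _ _ (measurableTypeR R) (measurableTypeR R)
  _ _ mc mu B f)//; last first.
  exact: measurable_funTS.
by apply: eq_measure_integral => A mA _; exact: lebesgue_measure_translate.
Qed.

End Translation.

(** * Normal laws and their first two moments *)

Section Gauss.
Context {R : realType}.
Local Notation mu := (@lebesgue_measure R).
Implicit Types (m tau s rho x : R) (B : set R).

Lemma normal_pdf_sqr m s s' : s ^+ 2 = s' ^+ 2 -> normal_pdf m s = normal_pdf m s'.
Proof.
move=> ss'; have s0 : (s == 0) = (s' == 0) by rewrite -sqrf_eq0 ss' sqrf_eq0.
by rewrite /normal_pdf /normal_peak /normal_fun s0 ss'.
Qed.

(** [multivariate_normal] leaves the sign of the standard deviation open, and the moments determine
    only its square. *)
Lemma gauss_sqr m tau tau' : tau ^+ 2 = tau' ^+ 2 -> gauss m tau = gauss m tau'.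
Proof.
move=> tt'; have t0 : (tau == 0) = (tau' == 0) by rewrite -sqrf_eq0 tt' sqrf_eq0.
by rewrite /gauss t0 /normal_prob (normal_pdf_sqr _ tt').
Qed.

Section GaussProb.
Variables m tau : R.

(** A copy of [gauss] with fixed parameters, to carry the structure of a probability, so that it can
    serve as an integrator and in products. *)
Definition gauss_prob (B : set R) : \bar R := gauss m tau B.

Let gauss0 : gauss_prob set0 = 0%E.
Proof. by rewrite /gauss_prob /gauss; case: ifP => _; rewrite measure0. Qed.

Let gauss_ge0 B : (0 <= gauss_prob B)%E.
Proof. by rewrite /gauss_prob /gauss; case: ifP. Qed.

Let gauss_sigma_additive : semi_sigma_additive gauss_prob.
Proof.
rewrite /gauss_prob /gauss; case: ifP => _; first exact: measure_semi_sigma_additive.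
exact: (@measure_semi_sigma_additive _ (measurableTypeR R) R (normal_prob m tau)).
Qed.

HB.instance Definition _ := isMeasure.Build _ _ _
  gauss_prob gauss0 gauss_ge0 gauss_sigma_additive.

Let gauss_setT : gauss_prob [set: R] = 1%E.
Proof.
rewrite /gauss_prob /gauss; case: ifP => _; first by rewrite diracT.
exact: integral_normal_pdf.
Qed.

HB.instance Definition _ :=
  @Measure_isProbability.Build _ _ R gauss_prob gauss_setT.

End GaussProb.

Lemma gauss_translate m c tau B : measurable B ->
  gauss (m + c) tau B = gauss m tau ((fun x => x + c) @^-1` B).
Proof.
move=> mB; rewrite /gauss; case: ifPn => [_|t0]; first by rewrite !diracE.
rewrite /normal_prob -(@ge0_integral_translate _ _ c)//.
- apply: eq_integral => x _; rewrite !normal_pdfE// /normal_fun.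
  by rewrite (_ : x + c - (m + c) = x - m)//; ring.
- by apply/measurable_EFinP; exact: measurable_normal_pdf.
- by move=> x; rewrite lee_fin normal_pdf_ge0.
Qed.

Lemma normal_peak_scale s : 0 < s -> normal_peak s * s = (Num.sqrt (pi *+ 2))^-1.
Proof.
move=> s0; rewrite /normal_peak -mulrnAr sqrtrM ?sqr_ge0// sqrtr_sqr gtr0_norm//.
by rewrite invfM mulrAC mulVf ?mul1r// gt_eqF.
Qed.

(* [exp t >= 1 + t], with [t] the difference of the two exponents. *)
Lemma normal_pdf_ge_scale m s rho x : 0 < s -> 0 < rho ->
  s * normal_pdf m s x * (1 + ((s ^+ 2 *+ 2)^-1 - (rho ^+ 2 *+ 2)^-1) * (x - m) ^+ 2)
  <= rho * normal_pdf m rho x.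
Proof.
move=> s0 r0; rewrite !normal_pdfE ?gt_eqF//; set c := 1 + _.
rewrite (_ : s * _ * c = normal_peak s * s * (normal_fun m s x * c)); last by ring.
rewrite (_ : rho * _ = normal_peak rho * rho * normal_fun m rho x); last by ring.
rewrite !normal_peak_scale//.
rewrite ler_wpM2l ?invr_ge0 ?sqrtr_ge0// /normal_fun /c.
set a := - (x - m) ^+ 2 / (s ^+ 2 *+ 2).
set b := - (x - m) ^+ 2 / (rho ^+ 2 *+ 2).
rewrite (_ : _ * (x - m) ^+ 2 = b - a); last by rewrite /a /b; ring.
rewrite -[leRHS]mul1r -[in leRHS](subrK a b) expRD mulrA mulrC mul1r.
by rewrite ler_wpM2r ?expR_ge0// expR_ge1Dx.
Qed.

(** Again [exp t >= 1 + t], applied to the difference of the exponents of two densities with equal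
    spread and shifted centres. *)
Lemma normal_pdf_ge_shift m s t x : s != 0 ->
  normal_pdf m s x * (1 + (t * (x - m) - t ^+ 2 / 2) / s ^+ 2) <=
  normal_pdf (m + t) s x.
Proof.
move=> s0; rewrite !normal_pdfE// -!mulrA ler_wpM2l ?normal_peak_ge0//.
rewrite /normal_fun.
set a := - (x - m) ^+ 2 / (s ^+ 2 *+ 2).
set b := - (x - (m + t)) ^+ 2 / (s ^+ 2 *+ 2).
rewrite (_ : _ / s ^+ 2 = b - a); last by rewrite /a /b; field.
rewrite -[in leRHS](subrK a b) expRD mulrC.
by rewrite ler_wpM2r ?expR_ge0// expR_ge1Dx.
Qed.

Let mpdf m s : measurable_fun setT (EFin \o normal_pdf m s).
Proof. by apply/measurable_EFinP; exact: measurable_normal_pdf. Qed.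

Let msq m s : measurable_fun setT (fun x => ((x - m) ^+ 2 * normal_pdf m s x)%:E).
Proof.
apply/measurable_EFinP; apply: measurable_funM; last exact: measurable_normal_pdf.
by apply: measurable_funX; exact: measurable_funB.
Qed.

Let sq0 m s x : (0 <= ((x - m) ^+ 2 * normal_pdf m s x)%:E)%E.
Proof. by rewrite lee_fin mulr_ge0 ?sqr_ge0 ?normal_pdf_ge0. Qed.

Let half_inv_sqr_sub s rho : s != 0 -> rho != 0 ->
  (s ^+ 2 *+ 2)^-1 - (rho ^+ 2 *+ 2)^-1 = (rho ^+ 2 - s ^+ 2) / (2 * s ^+ 2 * rho ^+ 2).
Proof. by move=> s0 r0; field; apply/andP. Qed.

Let scaled_mass m s : 0 < s ->
  (\int[mu]_x (s%:E * (normal_pdf m s x)%:E) = s%:E)%E.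
Proof.
move=> s0; rewrite ge0_integralZl_EFin// ?ltW// ?integral_normal_pdf ?mule1//.
- by move=> x _; rewrite lee_fin normal_pdf_ge0.
- exact: mpdf.
Qed.

(* No calculus: [normal_pdf_ge_scale] bounds the second moment above by rho ^+ 2
   for every rho > s, and below for every rho < s. *)
Lemma normal_sqr_moment m s : s != 0 ->
  (\int[mu]_x ((x - m) ^+ 2 * normal_pdf m s x)%:E = (s ^+ 2)%:E)%E.
Proof.
wlog s0 : s / 0 < s.
  move=> H s0; rewrite -(real_normK (num_real s)) -H ?normr_gt0 ?normr_eq0//.
  by rewrite (@normal_pdf_sqr _ s `|s|)// real_normK ?num_real.
move=> _; set M := (X in X = _).
have M0 : (0 <= M)%E by apply: integral_ge0 => x _.
have up rho : s < rho -> (M <= (rho ^+ 2)%:E)%E.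
  move=> srho; have r0 : 0 < rho by apply: lt_trans srho.
  set c := (s ^+ 2 *+ 2)^-1 - (rho ^+ 2 *+ 2)^-1.
  have c0 : 0 < c.
    rewrite /c half_inv_sqr_sub ?gt_eqF// divr_gt0 ?mulr_gt0 ?exprn_gt0//.
    by rewrite subr_gt0 ltr_pXn2r// ?nnegrE ltW.
  have sum0 x : (0 <= (normal_pdf m s x)%:E +
      c%:E * ((x - m) ^+ 2 * normal_pdf m s x)%:E)%E.
    apply: adde_ge0; first by rewrite lee_fin normal_pdf_ge0.
    by apply: mule_ge0 => //; rewrite lee_fin ltW.
  have Is : (\int[mu]_x (s%:E * ((normal_pdf m s x)%:E +
      c%:E * ((x - m) ^+ 2 * normal_pdf m s x)%:E)) = s%:E * (1 + c%:E * M))%E.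
    rewrite ge0_integralZl_EFin// ?ltW//; last first.
      apply: emeasurable_funD; first exact: mpdf.
      by apply: measurable_funeM; exact: msq.
    rewrite ge0_integralD//; last 4 first.
      by move=> x _; rewrite lee_fin normal_pdf_ge0.
      exact: mpdf.
      by move=> x _; apply: mule_ge0; [rewrite lee_fin ltW|exact: sq0].
      apply: measurable_funeM; exact: msq.
    rewrite integral_normal_pdf ge0_integralZl_EFin//; first exact: msq.
    exact: ltW.

  have : (s%:E * (1 + c%:E * M) <= rho%:E)%E.
    rewrite -Is -(scaled_mass m r0).
    apply: ge0_le_integral => //.
    - by move=> x _; apply: mule_ge0; [rewrite lee_fin ltW|exact: sum0].
    - apply: measurable_funeM; apply: emeasurable_funD; first exact: mpdf.
      apply: measurable_funeM; exact: msq.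
    - apply: measurable_funeM; exact: mpdf.
    - move=> x _; rewrite lee_fin.
      apply: le_trans (normal_pdf_ge_scale m x s0 r0).
      by rewrite -/c le_eqVlt; apply/orP; left; apply/eqP; ring.
  clear Is sum0.
  case: M M0 => [M| |]//=; last first.
    by rewrite gt0_muley ?lte_fin// addey// gt0_muley ?lte_fin// leye_eq.
  rewrite !lee_fin => M0.
  rewrite -ler_pdivlMl// -lerBrDl -ler_pdivlMl// => /le_trans; apply.
  rewrite /c half_inv_sqr_sub ?gt_eqF//.
  have sr : 0 < rho + s by rewrite addr_gt0.
  (* As c = (rho^2 - s^2) / (2 s^2 rho^2), the bound (rho/s - 1) / c simplifies to rho^2 * 2s / (rho
     + s), which is at most rho^2 because s < rho. *)
  rewrite (_ : _^-1 * _ = rho ^+ 2 * (2 * s / (rho + s))); last first.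
    by rewrite subr_sqr; field; rewrite !gt_eqF ?subr_gt0.
  rewrite ger_pMr ?exprn_gt0// ler_pdivrMr// mul1r; lra.
have down rho : 0 < rho -> rho < s -> ((rho ^+ 2)%:E <= M)%E.
  move=> r0 srho.
  set c := (rho ^+ 2 *+ 2)^-1 - (s ^+ 2 *+ 2)^-1.
  have c0 : 0 < c.
    rewrite /c half_inv_sqr_sub ?gt_eqF// divr_gt0 ?mulr_gt0 ?exprn_gt0//.
    by rewrite subr_gt0 ltr_pXn2r// ?nnegrE ltW.
  have sc0 : 0 <= s * c by rewrite mulr_ge0 ?ltW.
  (* With rho < s the correction has a negative coefficient; it is moved to the other side of the
     inequality so that every integrand stays nonnegative. *)
  have Ir : (\int[mu]_x (rho%:E * (normal_pdf m rho x)%:E +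
      (s * c)%:E * ((x - m) ^+ 2 * normal_pdf m s x)%:E) =
      rho%:E + (s * c)%:E * M)%E.
    rewrite ge0_integralD//; last 4 first.
      by move=> x _; apply: mule_ge0; rewrite lee_fin ?normal_pdf_ge0 ?ltW.
      by apply: measurable_funeM; exact: mpdf.
      by move=> x _; apply: mule_ge0; [rewrite lee_fin|exact: sq0].
      apply: measurable_funeM; exact: msq.
    by rewrite (scaled_mass m r0) ge0_integralZl_EFin//; exact: msq.
  have : (s%:E <= rho%:E + (s * c)%:E * M)%E.
    rewrite -Ir -[leLHS](scaled_mass m s0).
    apply: ge0_le_integral => //.
    - by move=> x _; apply: mule_ge0; rewrite lee_fin ?normal_pdf_ge0 ?ltW.
    - by apply: measurable_funeM; exact: mpdf.
    - by apply: emeasurable_funD; apply: measurable_funeM; [exact: mpdf|exact: msq].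
    - move=> x _; rewrite lee_fin.
      have := normal_pdf_ge_scale m x s0 r0.
      rewrite -[X in 1 + X * _]opprB -/c => H.
      by rewrite -lerBlDr; apply: le_trans H; rewrite le_eqVlt; apply/orP; left; apply/eqP; ring.
  clear up Ir.
  case: M M0 => [M| |]; [|by move=> *; rewrite leey|by rewrite leeNy_eq].
  rewrite !lee_fin => M0.
  rewrite -lerBlDl -ler_pdivrMl ?mulr_gt0//; apply: le_trans.
  rewrite /c half_inv_sqr_sub ?gt_eqF//.
  have sr : 0 < rho + s by rewrite addr_gt0.
  rewrite (_ : _^-1 * _ = rho ^+ 2 * (2 * s / (rho + s))); last first.
    by rewrite subr_sqr; field; rewrite !gt_eqF ?subr_gt0// addrC.
  rewrite ler_pMr ?exprn_gt0// ler_pdivlMr// mul1r; lra.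
(* One instance of [up] excludes an infinite moment. If s and the root of M differed, their midpoint
   as rho would contradict [up] or [down]. *)
have /(up _) : s < 2 * s by lra.
case: M M0 up down => [M| |]//; rewrite lee_fin => M0 up down _.
congr (_%:E); rewrite -[LHS]sqr_sqrtr//; congr (_ ^+ 2).
apply/eqP; rewrite eq_le; apply/andP; split; rewrite leNgt; apply/negP => H.
  have := up ((s + Num.sqrt M) / 2); rewrite lee_fin.
  rewrite -[X in X <= _](sqr_sqrtr M0) ler_pXn2r ?nnegrE ?sqrtr_ge0//; last first.
    by rewrite divr_ge0 ?addr_ge0 ?sqrtr_ge0 ?ltW.
  have : s < (s + Num.sqrt M) / 2 by lra.
  by move=> /[swap] /[apply]; lra.
have := down ((s + Num.sqrt M) / 2); rewrite lee_fin.
have p0 : 0 < (s + Num.sqrt M) / 2 by rewrite divr_gt0// ltr_wpDr ?sqrtr_ge0.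
rewrite -[X in _ <= X](sqr_sqrtr M0) ler_pXn2r ?nnegrE ?sqrtr_ge0 ?(ltW p0) ?(ltW s0)//.
move=> /(_ p0); have : (s + Num.sqrt M) / 2 < s by lra.
by move=> /[swap] /[apply]; lra.
Qed.


(** Dominated through |y| <= y^2 + 1, which is why the second moment is computed before the mean. *)
Let centered_integrable m s : s != 0 ->
  mu.-integrable setT (fun x => ((x - m) * normal_pdf m s x)%:E).
Proof.
move=> s0; apply: (@le_integrable _ (measurableTypeR R) R mu _ measurableT _
  (fun x => ((x - m) ^+ 2 * normal_pdf m s x)%:E + (normal_pdf m s x)%:E)%E).
- apply/measurable_EFinP; apply: measurable_funM; last exact: measurable_normal_pdf.
  exact: measurable_funB.
- move=> x _; have p0 := normal_pdf_ge0 m s x.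
  rewrite -EFinD (_ : _ + normal_pdf m s x = ((x - m) ^+ 2 + 1) * normal_pdf m s x); last by ring.
  rewrite /= lee_fin !normrM (ger0_norm p0) ler_wpM2r//.
  rewrite [leRHS]ger0_norm ?addr_ge0 ?sqr_ge0// -real_normK ?num_real//.
  by have := sqr_ge0 (`|x - m| - 1 : R); have := normr_ge0 (x - m); nra.
- apply: integrableD => //; last exact: integrable_normal_pdf.
  apply/integrableP; split; first exact: msq.
  under eq_integral do rewrite gee0_abs ?sq0//.
  by rewrite normal_sqr_moment// ltry.
Qed.

(* [normal_pdf_ge_shift] gives t * M <= t ^+ 2 / 2 for the mean M and all t. *)
Lemma normal_centered_mean m s : s != 0 ->
  (\int[mu]_x ((x - m) * normal_pdf m s x)%:E = 0)%E.
Proof.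
move=> s0; have I := centered_integrable m s0.
set M := (X in X = _).
have Mfin : M \is a fin_num by exact: integrable_fin_num I.
suff H t : t * fine M <= t ^+ 2 / 2.
  rewrite -(fineK Mfin); congr (_%:E).
  (* At t = M the bound reads M^2 <= M^2 / 2, which forces M = 0. *)
  have := H (fine M); have := sqr_ge0 (fine M); rewrite -expr2 => a b.
  by apply/eqP; rewrite -sqrf_eq0; apply/eqP; lra.
pose c := 1 - t ^+ 2 / 2 / s ^+ 2.
have Ip := integrable_normal_pdf m s.
have Ia : (\int[mu]_x (c%:E * (normal_pdf m s x)%:E +
    (t / s ^+ 2)%:E * ((x - m) * normal_pdf m s x)%:E) = c%:E + (t / s ^+ 2)%:E * M)%E.
  rewrite integralD//; [|exact: integrableZl|exact: integrableZl].
  by rewrite !integralZl// integral_normal_pdf mule1.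
have : (c%:E + (t / s ^+ 2)%:E * M <= 1)%E.
  rewrite -Ia -(integral_normal_pdf (m + t) s); apply: le_integral => //.
  - by apply: integrableD => //; exact: integrableZl.
  - exact: integrable_normal_pdf.
  - move=> x _; rewrite lee_fin; apply: le_trans (normal_pdf_ge_shift m t x s0).
    by rewrite le_eqVlt; apply/orP; left; apply/eqP; rewrite /c; field.
rewrite -(fineK Mfin) lee_fin /c -lerBrDl opprB addrCA subrr addr0.
by rewrite mulrAC ler_pM2r// invr_gt0 exprn_even_gt0.
Qed.

(** [normal_prob] lives on [measurableTypeR R]; this identity carries it over to [R] with its own
    measurable structure. *)
Let mid : measurable_fun setT (idfun : measurableTypeR R -> R).
Proof. by move=> _ B mB; rewrite setTI preimage_id. Qed.

Lemma ge0_integral_gauss m tau (f : R -> \bar R) : tau != 0 ->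
  measurable_fun setT f -> (forall x, 0 <= f x)%E ->
  (\int[gauss_prob m tau]_x f x = \int[mu]_x (f x * (normal_pdf m tau x)%:E))%E.
Proof.
move=> t0 mf f0.
rewrite -(@ge0_integral_density _ (measurableTypeR R) R mu (normal_prob m tau))//; last 2 first.
- exact: measurable_normal_pdf.
- exact: normal_pdf_ge0.
rewrite -[RHS](@ge0_integral_pushforward _ _ _ _ _ _ mid (normal_prob m tau) setT f)//.
by apply: eq_measure_integral => A mA _; rewrite /= /gauss_prob /gauss (negbTE t0).
Qed.

Lemma integral_gauss m tau (f : R -> R) : tau != 0 -> measurable_fun setT f ->
  (\int[gauss_prob m tau]_x (f x)%:E = \int[mu]_x (f x * normal_pdf m tau x)%:E)%E.
Proof.
move=> t0 mf; rewrite integralE [RHS]integralE.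
have mfE : measurable_fun setT (EFin \o f) by exact/measurable_EFinP.
rewrite (ge0_integral_gauss _ t0 (measurable_funepos mfE))//.
rewrite (ge0_integral_gauss _ t0 (measurable_funeneg mfE))//.
have p0 := normal_pdf_ge0 m tau.
congr (_ - _)%E; apply: eq_integral => x _.
- by rewrite !funeposE -!EFin_max -EFinM maxr_pMl// mul0r.
- by rewrite !funenegE -!EFin_max -EFinM maxr_pMl// mul0r mulNr.
Qed.

Lemma gauss_variance m tau :
  (\int[gauss_prob m tau]_x ((x - m) ^+ 2)%:E = (tau ^+ 2)%:E)%E.
Proof.
have mf : measurable_fun setT (fun x : R => ((x - m) ^+ 2)).
  by apply: measurable_funX; exact: measurable_funB.
have [->|t0] := eqVneq tau 0.
  rewrite (eq_measure_integral \d_m); last first.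
    by move=> A mA _ /=; rewrite /gauss_prob /gauss eqxx.
  rewrite integral_dirac//; last exact/measurable_EFinP.
  by rewrite diracT mul1e subrr.
by rewrite integral_gauss// normal_sqr_moment.
Qed.

Lemma gauss_mean m tau : (\int[gauss_prob m tau]_x (x - m)%:E = 0)%E.
Proof.
have mf : measurable_fun setT (fun x : R => x - m) by exact: measurable_funB.
have [->|t0] := eqVneq tau 0.
  rewrite (eq_measure_integral \d_m); last first.
    by move=> A mA _ /=; rewrite /gauss_prob /gauss eqxx.
  rewrite integral_dirac//; last exact/measurable_EFinP.
  by rewrite diracT mul1e subrr.
by rewrite integral_gauss// normal_centered_mean.
Qed.

End Gauss.

Section PushforwardMeasure.
Context d1 d2 (T1 : measurableType d1) (T2 : measurableType d2) (R : realType).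
Variables (m : {measure set T1 -> \bar R}) (f : T1 -> T2).

Definition mpushforward (mf : measurable_fun setT f) : {measure set T2 -> \bar R} :=
  measure_function_pushforward__canonical__measure_function_Measure m mf.

End PushforwardMeasure.

Lemma finite_measure_prod_unique d1 d2 (T1 : measurableType d1)
    (T2 : measurableType d2) (R : realType)
    (m1 m2 : {measure set (T1 * T2) -> \bar R}) :
  (m1 setT < +oo)%E ->
  (forall A B, measurable A -> measurable B -> m1 (A `*` B) = m2 (A `*` B)) ->
  forall X, measurable X -> m1 X = m2 X.
Proof.
move=> m1oo m12 X mX.
pose C : set (set (T1 * T2)) :=
  [set C | exists A, measurable A /\ exists B, measurable B /\ C = A `*` B].
apply: (measure_unique C (fun=> setT)) => //.
- rewrite measurable_prod_measurableType //; congr (<<s _ >>).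
  rewrite predeqE; split => [[A mA [B mB <-]]|[A [mA [B [mB ->]]]]].
    by exists A; split => //; exists B.
  by exists A => //; exists B.
- move=> /= _ _ [X1 [mX1 [X2 [mX2 ->]]]] [Y1 [mY1 [Y2 [mY2 ->]]]].
  rewrite -setXI; exists (X1 `&` Y1); split; first exact: measurableI.
  by exists (X2 `&` Y2); split => //; exact: measurableI.
- by move=> _; exists setT; split => //; exists setT; rewrite setXTT.
- by rewrite bigcup_const//; exists 0%N.
- by move=> A [A1 [mA1 [A2 [mA2 ->]]]]; exact: m12.
Qed.

(** * Convolution and scaling of normal laws *)

Section Convolution.
Context {R : realType}.
Local Notation mu := (@lebesgue_measure R).
Implicit Types (m tau s t x : R) (B : set R).

(** After translation to mean 0 the value at x is the measure of the section at x of a measurable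
    set of the plane. *)
Lemma measurable_gauss tau B : measurable B ->
  measurable_fun setT (fun x : R => gauss x tau B).
Proof.
move=> mB; pose S := (fun z : R * R => z.2 + z.1) @^-1` B.
have mS : measurable S.
  rewrite -[S]setTI; have mf : measurable_fun setT (fun z : R * R => z.2 + z.1).
    by apply: measurable_funD.
  exact: mf.
rewrite (_ : (fun x => _) = gauss_prob 0 tau \o xsection S).
  exact: measurable_fun_xsection.
apply/funext => x; rewrite -[in LHS](add0r x) gauss_translate//=.
by congr (gauss _ _ _); apply/seteqP; split => y; rewrite /xsection/= inE.
Qed.

(** Completing the square in x: the joint density of X and Z = X + X', with X and X' independent, is
    rewritten as the density of Z times the conditional density of X given Z = z. *)
Let normal_pdf_mul t1 t2 r x z : 0 < t1 -> 0 < t2 -> 0 < r ->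
  r ^+ 2 = t1 ^+ 2 + t2 ^+ 2 ->
  normal_pdf 0 t1 x * normal_pdf x t2 z =
  normal_pdf 0 r z * normal_pdf (z * t1 ^+ 2 / r ^+ 2) (t1 * t2 / r) x.
Proof.
move=> t10 t20 r0 rE.
have q0 : 0 < t1 * t2 / r by rewrite divr_gt0 ?mulr_gt0.
have peakE t : 0 < t -> normal_peak t = (Num.sqrt (pi *+ 2))^-1 / t.
  by move=> t0; rewrite -(normal_peak_scale t0) mulfK// gt_eqF.
rewrite !normal_pdfE ?gt_eqF// !peakE// /normal_fun.
set K := (Num.sqrt _)^-1.
rewrite [LHS](_ : _ = K ^+ 2 / t1 / t2 * (expR (- (x - 0) ^+ 2 / (t1 ^+ 2 *+ 2)) *
  expR (- (z - x) ^+ 2 / (t2 ^+ 2 *+ 2)))); last by ring.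
rewrite [RHS](_ : _ = K ^+ 2 / r / (t1 * t2 / r) *
  (expR (- (z - 0) ^+ 2 / (r ^+ 2 *+ 2)) *
  expR (- (x - z * t1 ^+ 2 / r ^+ 2) ^+ 2 / ((t1 * t2 / r) ^+ 2 *+ 2)))); last by ring.
rewrite -!expRD; congr (_ * expR _).
  by field; rewrite !gt_eqF.
have t1n : t1 != 0 by rewrite gt_eqF.
have t2n : t2 != 0 by rewrite gt_eqF.
have rn : r != 0 by rewrite gt_eqF.
rewrite [(t1 * t2 / r) ^+ 2](_ : _ = t1 ^+ 2 * t2 ^+ 2 / r ^+ 2); last by field.
rewrite !rE; field; rewrite t1n t2n/=.
by rewrite -?rE ?expf_eq0 ?(negbTE rn).
Qed.

Lemma gauss_conv t1 t2 B : measurable B ->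
  (\int[gauss_prob 0 t1]_x gauss x t2 B = gauss 0 (Num.sqrt (t1 ^+ 2 + t2 ^+ 2)) B)%E.
Proof.
move=> mB.
wlog: t1 t2 / 0 <= t1 /\ 0 <= t2.
  move=> H; have tE (t : R) : t ^+ 2 = `|t| ^+ 2 by rewrite real_normK ?num_real.
  rewrite (tE t1) (tE t2) -H; last by split; exact: normr_ge0.
  rewrite (eq_measure_integral (gauss_prob 0 `|t1|)); last first.
    by move=> A _ _ /=; rewrite /gauss_prob (gauss_sqr _ (tE t1)).
  by apply: eq_integral => x _; rewrite (gauss_sqr _ (tE t2)).
move=> [t10 t20].
(* A zero standard deviation means a Dirac mass, which has no density, so these cases are settled
   first. *)
have [t1E|t1n] := eqVneq t1 0.
  rewrite (eq_measure_integral (dirac (0 : R))); last first.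
    by move=> A mA _ /=; rewrite /gauss_prob /gauss t1E eqxx.
  rewrite integral_dirac//; last exact: measurable_gauss.
  rewrite diracT mul1e; congr (_ _); apply: gauss_sqr.
  by rewrite sqr_sqrtr ?addr_ge0 ?sqr_ge0// t1E expr0n add0r.
have [t2E|t2n] := eqVneq t2 0.
  rewrite (_ : gauss 0 _ B = gauss_prob 0 t1 B); last first.
    rewrite /gauss_prob; congr (_ _); apply: gauss_sqr.
    by rewrite sqr_sqrtr ?addr_ge0 ?sqr_ge0// t2E expr0n addr0.
  rewrite -[in RHS](setIT B) -integral_indic//; apply: eq_integral => x _.
  by rewrite /gauss t2E eqxx diracE indicE.
have {t1n}t10 : 0 < t1 by rewrite lt_neqAle eq_sym t1n.
have {t2n}t20 : 0 < t2 by rewrite lt_neqAle eq_sym t2n.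
set r := Num.sqrt _.
have r0 : 0 < r by rewrite sqrtr_gt0 addr_gt0 ?exprn_gt0.
have rE : r ^+ 2 = t1 ^+ 2 + t2 ^+ 2 by rewrite sqr_sqrtr ?addr_ge0 ?sqr_ge0.
rewrite ge0_integral_gauss ?gt_eqF//; last 2 first.
- exact: measurable_gauss.
- by move=> x; exact: measure_ge0 (gauss_prob x t2) B.
(* The joint density of a first summand and the sum, cut off to the event that the sum lies in B. *)
pose f (u : measurableTypeR R * measurableTypeR R) : \bar R :=
  (normal_pdf 0 t1 u.1 * normal_pdf 0 t2 (u.2 - u.1) * \1_B u.2)%:E.
have shiftE x z : normal_pdf x t2 z = normal_pdf 0 t2 (z - x).
  by rewrite !normal_pdfE ?gt_eqF// /normal_fun subr0.
have f0 u : (0 <= f u)%E by rewrite lee_fin !mulr_ge0 ?normal_pdf_ge0.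
have mf : measurable_fun setT f.
  apply/measurable_EFinP; apply: measurable_funM; last first.
    by apply: measurableT_comp => //; exact: measurable_indic.
  apply: measurable_funM.
    by apply: measurableT_comp; [exact: measurable_normal_pdf|].
  apply: measurableT_comp; first exact: measurable_normal_pdf.
  by apply: measurable_funB.
transitivity (\int[mu]_x \int[mu]_z f (x, z))%E.
  apply: eq_integral => x _; rewrite /gauss gt_eqF// /normal_prob.
  rewrite muleC -ge0_integralZl_EFin//; last 3 first.
  - by move=> y _; rewrite lee_fin normal_pdf_ge0.
  - by apply: measurable_funTS; apply/measurable_EFinP; exact: measurable_normal_pdf.
  - exact: normal_pdf_ge0.
  rewrite integral_mkcond; apply: eq_integral => z _.
  by rewrite epatch_indic /f/= -EFinM shiftE.
rewrite (fubini_tonelli f)//.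
transitivity (\int[mu]_(z in B) (normal_pdf 0 r z)%:E)%E; last first.
  by rewrite /gauss gt_eqF.
rewrite [RHS]integral_mkcond; apply: eq_integral => z _.
(* The inserted factor 1 becomes the total mass of the conditional density of x given z. *)
rewrite epatch_indic /= -EFinM -[RHS]mule1.
rewrite -(integral_normal_pdf (z * t1 ^+ 2 / r ^+ 2) (t1 * t2 / r)).
rewrite -ge0_integralZl_EFin//; last 3 first.
- by move=> y _; rewrite lee_fin normal_pdf_ge0.
- by apply/measurable_EFinP; exact: measurable_normal_pdf.
- by rewrite mulr_ge0 ?normal_pdf_ge0.
apply: eq_integral => x _; rewrite /f /= -EFinM -shiftE (normal_pdf_mul _ _ t10 t20 r0 rE).
by congr (_%:E); ring.
Qed.

End Convolution.

Section Scaling.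
Context {R : realType}.
Local Notation mu := (@lebesgue_measure R).

Let mulc (c : R) := fun x : measurableTypeR R => c * x : measurableTypeR R.

Let measurable_mulc c : measurable_fun setT (mulc c).
Proof. exact: measurable_funM. Qed.

Lemma lebesgue_measure_scale (c : R) (A : set R) : c != 0 -> measurable A ->
  (`|c|%:E * pushforward mu (mulc c) A = mu A)%E.
Proof.
move=> c0 mA; apply/esym.
rewrite -[RHS]/(mscale (NngNum (normr_ge0 c)) (mpushforward mu (measurable_mulc c)) A).
apply: lebesgue_measure_unique => //= _ [[x y]] _ <-.
rewrite /mscale /= /pushforward /mulc.
case: (ltrgt0P c) c0 => [cp _|cn _|//].
- rewrite (_ : _ @^-1` _ = `](x / c)%R, (y / c)%R]%classic).
    rewrite !lebesgue_measure_itv/= !lte_fin ltr_pM2r ?invr_gt0//; case: ifP => _.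
      by rewrite -!EFinD -EFinM; congr (_%:E); field; rewrite gt_eqF.
    by rewrite mule0.
  by apply/seteqP; split => z /=; rewrite !in_itv/= ltr_pdivrMr// ler_pdivlMr// mulrC.
(* A negative factor reverses the interval, and with it the end that is closed; the Lebesgue measure
   does not see the difference. *)
- rewrite (_ : _ @^-1` _ = `[(y / c)%R, (x / c)%R[%classic).
    rewrite !lebesgue_measure_itv/= !lte_fin ltr_nM2r ?invr_lt0//; case: ifP => _.
      by rewrite -!EFinD -EFinM; congr (_%:E); field; rewrite lt_eqF.
    by rewrite mule0.
  apply/seteqP; split => z /=; rewrite !in_itv/= ltr_ndivlMr// ler_ndivrMr// mulrC;
    by rewrite andbC.
Qed.

(** The factor c may vanish: it will be the sum of the coefficients of a form supported at the
    root. *)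
Lemma gauss_scale (c tau : R) (B : set R) : measurable B ->
  gauss 0 tau ((fun x => c * x) @^-1` B) = gauss 0 (c * tau) B.
Proof.
move=> mB; rewrite /gauss mulf_eq0.
have [->|t0] := eqVneq tau 0.
  rewrite orbT !diracE (_ : (0 \in _ @^-1` B) = (0 \in B))//.
  by apply/idP/idP; rewrite !inE/= mulr0.
have [->|c0] /= := eqVneq c 0.
  rewrite diracE /normal_prob; have [B0|B0] := pselect (B 0).
    rewrite mem_set// (_ : _ @^-1` B = setT) ?integral_normal_pdf//.
    by apply/seteqP; split => x //= _; rewrite mul0r.
  rewrite memNset// (_ : _ @^-1` B = set0) ?integral_set0//.
  by apply/seteqP; split => x //=; rewrite mul0r.
rewrite /normal_prob.
have mp : measurable_fun setT (fun x : R => (normal_pdf 0 (c * tau) x)%:E).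
  by apply/measurable_EFinP; exact: measurable_normal_pdf.
have -> : (\int[mu]_(x in B) (normal_pdf 0 (c * tau) x)%:E =
    \int[mscale (NngNum (normr_ge0 c)) (mpushforward mu (measurable_mulc c))]_(x in B)
      (normal_pdf 0 (c * tau) x)%:E)%E.
  apply: eq_measure_integral => A mA _; rewrite /= /mscale/=.
  by rewrite -(lebesgue_measure_scale c0).
rewrite ge0_integral_mscale//; last 2 first.
- exact: measurable_funTS.
- by move=> x _; rewrite lee_fin normal_pdf_ge0.
rewrite (@ge0_integral_pushforward _ _ (measurableTypeR R) (measurableTypeR R) _ _
  (measurable_mulc c))//; last 2 first.
- exact: measurable_funTS.
- by move=> x _; rewrite lee_fin normal_pdf_ge0.
have mD : measurable (mulc c @^-1` B).
  by rewrite -[X in measurable X]setTI; exact: measurable_mulc.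
rewrite -ge0_integralZl_EFin//; last 2 first.
- by move=> x _; rewrite lee_fin normal_pdf_ge0.
- by apply: measurable_funTS; apply: measurableT_comp => //; exact: measurable_mulc.
apply: eq_integral => x _; rewrite /= -EFinM; congr (_%:E).
rewrite !normal_pdfE ?mulf_neq0//.
have -> : normal_fun 0 (c * tau) (mulc c x) = normal_fun 0 tau x.
  by rewrite /normal_fun /mulc !subr0; congr expR; field; rewrite ?c0 ?t0.
rewrite mulrA; congr (_ * _); rewrite /normal_peak.
rewrite (_ : (c * tau) ^+ 2 * pi *+ 2 = c ^+ 2 * (tau ^+ 2 * pi *+ 2)); last by ring.
by rewrite sqrtrM ?sqr_ge0// sqrtr_sqr invfM mulrA divff ?normr_eq0// mul1r.
Qed.

End Scaling.

Lemma ge0_integral_mrestr d (T : measurableType d) (R : realType)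
    (mu : {measure set T -> \bar R}) (E D : set T) (mE : measurable E) (f : T -> \bar R) :
  measurable D -> measurable_fun setT f -> (forall x, 0 <= f x)%E ->
  (\int[mrestr mu mE]_(x in D) f x = \int[mu]_(x in D `&` E) f x)%E.
Proof.
move=> mD mf f0; rewrite (@ge0_negligible_integral _ _ _ _ D (~` E))//.
- rewrite setDE setCK; apply: eq_measure_integral => A mA AS.
  by rewrite /= /mrestr setIidl// => x /AS[].
- exact: measurableC.
- exact: measurable_funTS.
- by rewrite /= /mrestr setICl measure0.
Qed.

(** * Random variables with a normal law *)

Section Law.
Context d (T : measurableType d) (R : realType) (Q : probability T R).
Variables (X : T -> R) (m tau : R).
Hypothesis mX : measurable_fun setT X.
Hypothesis lawX : forall B, measurable B -> Q (X @^-1` B) = gauss m tau B.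

Lemma ge0_integral_law (f : R -> \bar R) : measurable_fun setT f ->
  (forall x, 0 <= f x)%E -> (\int[Q]_w f (X w) = \int[gauss_prob m tau]_x f x)%E.
Proof.
move=> mf f0; rewrite -[LHS](@ge0_integral_pushforward _ _ _ _ _ _ mX Q setT f)//.
by apply: (eq_measure_integral (gauss_prob m tau)) => A mA _; exact: lawX.
Qed.

Lemma integral_law (f : R -> R) : measurable_fun setT f ->
  (\int[Q]_w (f (X w))%:E = \int[gauss_prob m tau]_x (f x)%:E)%E.
Proof.
move=> mf; rewrite integralE [RHS]integralE.
have mfE : measurable_fun setT (EFin \o f) by exact/measurable_EFinP.
rewrite -(ge0_integral_law (measurable_funepos mfE))//.
rewrite -(ge0_integral_law (measurable_funeneg mfE))//.
by congr (_ - _)%E; apply: eq_integral => w _; rewrite ?funeposE ?funenegE.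
Qed.

Lemma law_sqr : (\int[Q]_w ((X w - m) ^+ 2)%:E = (tau ^+ 2)%:E)%E.
Proof.
rewrite (integral_law (f := fun x => (x - m) ^+ 2)) ?gauss_variance//.
by apply: measurable_funX; exact: measurable_funB.
Qed.

Lemma law_sqr_integrable : Q.-integrable setT (fun w => ((X w - m) ^+ 2)%:E).
Proof.
apply/integrableP; split.
  by apply/measurable_EFinP; apply: measurable_funX; exact: measurable_funB.
under eq_integral do rewrite gee0_abs ?lee_fin ?sqr_ge0//.
by rewrite law_sqr ltry.
Qed.

Lemma law_integrable : Q.-integrable setT (EFin \o X).
Proof.
apply: (@le_integrable _ T R Q _ measurableT _
  (fun w => ((X w - m) ^+ 2)%:E + (1 + `|m|)%:E)%E).
- exact/measurable_EFinP.
- move=> w _; rewrite -EFinD/= lee_fin.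
  rewrite [leRHS]ger0_norm ?addr_ge0 ?sqr_ge0//.
  have := ler_normD (X w - m) m; rewrite subrK => /le_trans; apply.
  rewrite addrA lerD2r -real_normK ?num_real//.
  by have := sqr_ge0 (`|X w - m| - 1 : R); have := normr_ge0 (X w - m); nra.
- apply: integrableD => //; first exact: law_sqr_integrable.
  exact: finite_measure_integrable_cst.
Qed.

Lemma law_mean : (\int[Q]_w (X w)%:E = m%:E)%E.
Proof.
have mB : measurable_fun setT (fun x : R => x - m) by exact: measurable_funB.
have := integral_law mB; rewrite gauss_mean.
under eq_integral do rewrite EFinB.
rewrite integralB_EFin//; [|exact: law_integrable|exact: finite_measure_integrable_cst].
rewrite integral_cst//= probability_setT mule1 => H.
have fX := integrable_fin_num measurableT law_integrable.
by move: H; rewrite -(fineK fX) -EFinB => -[/eqP]; rewrite subr_eq0 => /eqP ->.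
Qed.

End Law.

Lemma integrable_mul_sqr d (T : measurableType d) (R : realType)
    (mu : {measure set T -> \bar R}) (f g : T -> R) :
  measurable_fun setT f -> measurable_fun setT g ->
  mu.-integrable setT (fun x => (f x ^+ 2)%:E) ->
  mu.-integrable setT (fun x => (g x ^+ 2)%:E) ->
  mu.-integrable setT (fun x => (f x * g x)%:E).
Proof.
move=> mf mg f2 g2; apply: (@le_integrable _ T R mu _ measurableT _
  (fun x => (f x ^+ 2)%:E + (g x ^+ 2)%:E)%E) => //.
- by apply/measurable_EFinP; exact: measurable_funM.
- move=> x _; rewrite -EFinD/= lee_fin [leRHS]ger0_norm ?addr_ge0 ?sqr_ge0//.
  rewrite normrM -(real_normK (num_real (f x))) -(real_normK (num_real (g x))).
  have := sqr_ge0 (`|f x| - `|g x| : R).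
  by have := normr_ge0 (f x); have := normr_ge0 (g x); nra.
- exact: integrableD.
Qed.

Lemma integral_sqr_sum d (T : measurableType d) (R : realType)
    (mu : {measure set T -> \bar R}) n (Z : 'I_n -> T -> R) (c : 'I_n -> R) :
  (forall i, measurable_fun setT (Z i)) ->
  (forall i, mu.-integrable setT (fun x => (Z i x ^+ 2)%:E)) ->
  (\int[mu]_x ((\sum_i c i * Z i x) ^+ 2)%:E =
   \sum_i \sum_j (c i * c j)%:E * \int[mu]_x (Z i x * Z j x)%:E)%E.
Proof.
move=> mZ Z2; have I i j := integrable_mul_sqr (mZ i) (mZ j) (Z2 i) (Z2 j).
transitivity (\int[mu]_x
    (\sum_i \sum_j (c i * c j)%:E * (Z i x * Z j x)%:E))%E.
  apply: eq_integral => x _; rewrite expr2 mulr_suml -sumEFin; apply: eq_bigr => i _.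
  rewrite mulr_sumr -sumEFin; apply: eq_bigr => j _.
  by rewrite -EFinM; congr (_%:E); ring.
rewrite integral_sum//; last first.
  by move=> i; apply: integrable_sum => // j _; exact: integrableZl.
apply: eq_bigr => i _; rewrite integral_sum//; last by move=> j; exact: integrableZl.
by apply: eq_bigr => j _; rewrite integralZl.
Qed.

(** Normality of a form comes with unknown parameters m and tau. Computing the mean and the variance
    of the form twice, from its law and from the data on the coordinates, identifies m and tau^2;
    the nonnegativity of the quadratic form is that of tau^2. *)
Lemma multivariate_normal_linear (R : realType) n (K : probability (n.-tuple R) R)
    (mm : 'I_n -> R) (cc : 'I_n -> 'I_n -> R) :
  multivariate_normal K ->
  (forall i, 'E_K[fun x => tnth x i] = (mm i)%:E)%E ->
  (forall i j, covariance K (fun x => tnth x i) (fun x => tnth x j) = (cc i j)%:E) ->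
  forall c : 'I_n -> R, 0 <= \sum_i \sum_j c i * c j * cc i j /\
  forall B, measurable B ->
  K ((fun x => \sum_i c i * tnth x i) @^-1` B) =
  gauss (\sum_i c i * mm i) (Num.sqrt (\sum_i \sum_j c i * c j * cc i j)) B.
Proof.
move=> KN KE KC c.
have mt i : measurable_fun setT (fun x : n.-tuple R => tnth x i) by exact: measurable_tnth.
have law1 i : exists tau, forall B, measurable B ->
    K ((fun x => tnth x i) @^-1` B) = gauss (mm i) tau B.
  (* The form whose only coefficient is 1 at i shows that the coordinate itself is normal, hence
     square integrable; the expansions below depend on it. *)
  have [m [tau law]] := KN (fun j => (j == i)%:R).
  have law' B : measurable B -> K ((fun x => tnth x i) @^-1` B) = gauss m tau B.
    move=> mB; rewrite -law// /pushforward; congr (K _).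
    apply/seteqP; split => x /=; rewrite (bigD1 i)//= eqxx mul1r big1 ?addr0//;
      by move=> j /negbTE ->; rewrite mul0r.
  exists tau => B mB; rewrite law'//; congr (gauss _ _ _); apply: EFin_inj.
  by rewrite -KE unlock (law_mean (mt i) law').
have [m [tau lawc]] := KN c.
have mS : measurable_fun setT (fun x : n.-tuple R => \sum_i c i * tnth x i).
  by apply: measurable_sum => i; exact: measurable_funM.
have mE : m = \sum_i c i * mm i.
  apply: EFin_inj; rewrite -(law_mean mS lawc) -sumEFin.
  transitivity (\int[K]_x \sum_i (c i)%:E * (tnth x i)%:E)%E.
    by apply: eq_integral => x _; rewrite -sumEFin.
  have Ii i : K.-integrable setT (EFin \o (fun x => tnth x i)).
    by have [t /(law_integrable (mt i))] := law1 i.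
  rewrite integral_sum//; last by move=> i; apply: integrableZl => //; exact: Ii.
  apply: eq_bigr => i _; rewrite integralZl//; last exact: Ii.
  by have := KE i; rewrite unlock => ->.
have tauE : tau ^+ 2 = \sum_i \sum_j c i * c j * cc i j.
  apply: EFin_inj; rewrite -(law_sqr mS lawc).
  transitivity (\int[K]_x ((\sum_i c i * (tnth x i - mm i)) ^+ 2)%:E)%E.
    apply: eq_integral => x _; congr ((_ ^+ 2)%:E).
    by rewrite mE -sumrB; apply: eq_bigr => i _; rewrite mulrBr.
  rewrite (integral_sqr_sum (Z := fun i (x : n.-tuple R) => (tnth x i : R) - mm i)); last 2 first.
  - by move=> i; exact: measurable_funB.
  - by move=> i; have [t /(law_sqr_integrable (mt i))] := law1 i.
  rewrite -sumEFin; apply: eq_bigr => i _; rewrite -sumEFin; apply: eq_bigr => j _.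
  rewrite [RHS]EFinM -KC; congr (_ * _)%E; rewrite unlock !KE /= unlock.
  by apply: eq_integral.
split; first by rewrite -tauE sqr_ge0.
move=> B mB; rewrite -mE -tauE; have := lawc _ mB; rewrite /pushforward => ->.
by congr (_ B); apply: gauss_sqr; rewrite sqr_sqrtr ?sqr_ge0.
Qed.

(** The hypothesis says that, given V, the law of Z is normal around beta V. So the pair (V, Z) is
    distributed as the image under the shear (v, q) -> (v, q + beta v) of the law of V times N(0,
    tau^2), and undoing the shear leaves q. The measure is only finite, since it will be the
    restriction of P to an event. *)
Lemma residual_law d (T : measurableType d) (R : realType)
    (mu : {measure set T -> \bar R}) (V Z : T -> R) (beta tau : R) :
  (mu setT < +oo)%E -> measurable_fun setT V -> measurable_fun setT Z ->
  (forall C B, measurable C -> measurable B ->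
    mu (V @^-1` C `&` Z @^-1` B) =
    (\int[mu]_(w in V @^-1` C) gauss (beta * V w) tau B)%E) ->
  forall B, measurable B ->
  mu ((fun w => Z w - beta * V w) @^-1` B) = (mu setT * gauss 0 tau B)%E.
Proof.
move=> muoo mV mZ H B mB.
pose M := mpushforward mu mV.
have mVZ : measurable_fun setT (fun w => (V w, Z w)) by exact: measurable_fun_pair.
have mf : measurable_fun setT (fun u : R * R => (u.1, u.2 + beta * u.1)).
  apply: measurable_fun_pair => //; apply: measurable_funD => //.
  by apply: measurable_funM.
have mg : measurable_fun setT (fun u : R * R => u.2 - beta * u.1).
  by apply: measurable_funB => //; apply: measurable_funM.
pose D := (fun u : R * R => u.2 - beta * u.1) @^-1` B.
have mD : measurable D by rewrite -[D]setTI; exact: mg.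
have := @finite_measure_prod_unique _ _ _ _ _ (mpushforward mu mVZ)
  (mpushforward [the measure _ _ of (M \x gauss_prob 0 tau)%E] mf) muoo _ D mD.
rewrite /= /pushforward/=; move=> ->.
- rewrite (_ : _ @^-1` D = setT `*` B); last first.
    by rewrite /D; apply/seteqP; split => -[v q] /=; rewrite addrK// => -[].
  exact: (product_measure1E M (gauss_prob 0 tau) measurableT mB).
- move=> A C mA mC.
  rewrite [LHS](_ : _ = mu (V @^-1` A `&` Z @^-1` C))// H//.
  rewrite /product_measure1 -(@ge0_integral_pushforward _ _ _ _ _ _ mV mu A
    (fun v => gauss (beta * v) tau C))//; last 2 first.
  + apply: measurable_funTS; apply: (measurableT_comp (measurable_gauss tau mC)).
    exact: measurable_funM.
  + by move=> v _; exact: measure_ge0 (gauss_prob (beta * v) tau) C.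
  rewrite integral_mkcond; apply: eq_integral => v _; rewrite patchE.
  rewrite /xsection/=; case: ifPn => vA.
    rewrite -[beta * v]add0r gauss_translate//=; congr (gauss _ _ _).
    apply/seteqP; split => q /=; rewrite ?inE ?add0r//=; last by case.
    by move=> Cq; split => //; rewrite inE in vA.
  rewrite (_ : [set y | _] = set0) ?measure0//.
  apply/seteqP; split => q //=; rewrite inE/= => -[Av _].
  by move/negP: vA; apply; rewrite inE.
Qed.

Lemma indep_gauss_sum d (T : measurableType d) (R : realType) (Q : probability T R)
    (X Z : T -> R) (t1 t2 : R) :
  measurable_fun setT X -> measurable_fun setT Z ->
  (forall A B, measurable A -> measurable B ->
    Q (X @^-1` A `&` Z @^-1` B) = (gauss 0 t1 A * gauss 0 t2 B)%E) ->
  forall B, measurable B ->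
  Q ((fun w => X w + Z w) @^-1` B) = gauss 0 (Num.sqrt (t1 ^+ 2 + t2 ^+ 2)) B.
Proof.
move=> mX mZ H B mB.
have mXZ : measurable_fun setT (fun w => (X w, Z w)) by exact: measurable_fun_pair.
pose D := (fun u : R * R => u.1 + u.2) @^-1` B.
have mD : measurable D.
  have mf : measurable_fun setT (fun u : R * R => u.1 + u.2) by apply: measurable_funD.
  by rewrite -[D]setTI; exact: mf.
have DE := @product_measure_unique _ _ _ _ _ (gauss_prob 0 t1) (gauss_prob 0 t2)
  (mpushforward Q mXZ) H D mD.
transitivity (mpushforward Q mXZ D); first by [].
rewrite -DE /product_measure1 -gauss_conv//; apply: eq_integral => x _ /=.
rewrite -[in RHS](add0r x) gauss_translate//; congr (gauss _ _ _).
by apply/seteqP; split => q; rewrite /xsection/= inE /D /= addrC.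
Qed.

(** On the sub-sigma-algebra, p is the density with respect to P of the restriction of P to E, so
    this is a change of density. T' is T with the smaller sigma-algebra, and P and its restriction
    reach it by pushforward along the identity. *)
Lemma condexp_taking_out d (T : measurableType d) (R : realType) (P : probability T R)
    (G : set (set T)) (E : set T) (p g : T -> R) :
  G `<=` measurable -> measurable E ->
  is_condprob P <<s G >> E p -> (forall w, 0 <= p w) ->
  (forall B, measurable B -> <<s G >> (g @^-1` B)) -> (forall w, 0 <= g w) ->
  forall A, <<s G >> A ->
  (\int[P]_(w in A) (p w * g w)%:E = \int[P]_(w in A `&` E) (g w)%:E)%E.
Proof.
move=> GT mE [mp Ip pE] p0 mg g0 A sA.
have sGT : <<s G >> `<=` measurable.
  by apply: smallest_sub => //; exact: sigma_algebra_measurable.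
pose T' := g_sigma_algebraType G.
have mid : measurable_fun setT (idfun : T -> T').
  by move=> _ B mB; rewrite setTI; exact: sGT.
have mp' : measurable_fun setT (p : T' -> R) by move=> _ B mB; rewrite setTI; exact: mp.
have mg' : measurable_fun setT (g : T' -> R) by move=> _ B mB; rewrite setTI; exact: mg.
have mA := sGT _ sA.
have mpT : measurable_fun setT p by move=> _ B mB; rewrite setTI; apply: sGT; exact: mp.
have mgT : measurable_fun setT g by move=> _ B mB; rewrite setTI; apply: sGT; exact: mg.
pose P' := mpushforward P mid.
pose m := mpushforward (mrestr P mE) mid.
have mE' (B : set T') : measurable B -> m B = (\int[P']_(x in B) (p x)%:E)%E.
  move=> mB; rewrite (@ge0_integral_pushforward _ _ _ _ _ _ mid)//; last 2 first.
  - by apply: measurable_funTS; exact/measurable_EFinP.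
  - by move=> x _; rewrite lee_fin.
  rewrite [RHS]pE// integral_indic//; last exact: sGT.
  by rewrite setIC.
have h0 (x : T') : (0 <= ((fun x => (g x)%:E) \_ A) x)%E.
  by rewrite patchE; case: ifP => // _; rewrite lee_fin.
have mh : measurable_fun setT ((fun x => (g x)%:E) \_ A : T' -> \bar R).
  apply/(measurable_restrictT _ _).1 => //.
  by apply: measurable_funTS; exact/measurable_EFinP.
have := @ge0_integral_density _ T' R P' m p mp' p0 mE' _ mh h0.
rewrite !(@ge0_integral_pushforward _ _ _ _ _ _ mid)//; last 2 first.
- by apply: emeasurable_funM => //; exact/measurable_EFinP.
- by move=> x _; rewrite mule_ge0 ?lee_fin.
rewrite /= -integral_mkcond ge0_integral_mrestr//; last exact/measurable_EFinP.
move=> ->; rewrite integral_mkcond; apply: eq_integral => x _.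
by rewrite !patchE; case: ifP => _; rewrite /= ?mul0e// -EFinM mulrC.
Qed.

(** In E, both sides are finite measures, and they agree on a pi-system containing the whole
    space. *)
Lemma indep_pi_system d (T : measurableType d) (R : realType) (P : probability T R)
    (G : set (set T)) (S : set T) :
  G `<=` measurable -> setI_closed G -> G setT -> measurable S ->
  (forall E, G E -> P (E `&` S) = (P E * P S)%E) ->
  forall E, <<s G >> E -> P (E `&` S) = (P E * P S)%E.
Proof.
move=> GT GI GsetT mS H E sE.
have r0 : 0 <= fine (P S) by rewrite fine_ge0.
have := @g_sigma_algebra_measure_unique _ R T G GT (fun=> setT) _ _
  (mrestr P mS) (mscale (NngNum r0) P) GI.
rewrite /= /mrestr /mscale/= fineK ?fin_num_measure// => /(_ _ _ _ _ _ sE) ->.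
- by rewrite muleC.
- by [].
- by rewrite bigcup_const//; exists 0%N.
- by move=> A /H ->; rewrite muleC.
- by move=> _; rewrite setTI ltey_eq fin_num_measure.
Qed.

(** * Lengths of paths *)

Section EuclideanNorm.
Context {R : realType} {k : nat}.
Implicit Types (x y z : 'rV[R]_k) (c : R).

Lemma enorm_ge0 x : 0 <= enorm x. Proof. exact: sqrtr_ge0. Qed.

Lemma enorm0 : enorm (0 : 'rV[R]_k) = 0.
Proof. by rewrite /enorm big1 ?sqrtr0// => i _; rewrite mxE expr0n. Qed.

Lemma enormZ c x : enorm (c *: x) = `|c| * enorm x.
Proof.
rewrite /enorm -sqrtr_sqr -sqrtrM ?sqr_ge0//; congr Num.sqrt.
by rewrite mulr_sumr; apply: eq_bigr => i _; rewrite mxE exprMn.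
Qed.

Lemma enormN x : enorm (- x) = enorm x.
Proof. by rewrite -scaleN1r enormZ normrN1 mul1r. Qed.

Lemma enorm_distC x y : enorm (x - y) = enorm (y - x).
Proof. by rewrite -enormN opprB. Qed.

(** Lagrange's identity: the difference of the two sides is half of a double sum of squares. *)
Lemma cauchy_schwarz (f g : 'I_k -> R) :
  (\sum_i f i * g i) ^+ 2 <= (\sum_i f i ^+ 2) * (\sum_i g i ^+ 2).
Proof.
have : 0 <= \sum_i \sum_j (f i * g j - f j * g i) ^+ 2.
  by apply: sumr_ge0 => i _; apply: sumr_ge0 => j _; exact: sqr_ge0.
have -> : \sum_i \sum_j (f i * g j - f j * g i) ^+ 2 =
    \sum_i \sum_j f i ^+ 2 * g j ^+ 2 + \sum_i \sum_j f j ^+ 2 * g i ^+ 2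
    - 2 * \sum_i \sum_j (f i * g i) * (f j * g j).
  rewrite mulr_sumr -sumrN -!big_split/=; apply: eq_bigr => i _.
  rewrite mulr_sumr -sumrN -!big_split/=; apply: eq_bigr => j _; ring.
rewrite [X in _ + X - _]exchange_big/=.
have D (F G : 'I_k -> R) :
    \sum_i \sum_j F i * G j = (\sum_i F i) * (\sum_j G j) by rewrite big_distrlr.
rewrite (D (fun i => f i ^+ 2) (fun i => g i ^+ 2)).
rewrite (D (fun i => f i * g i) (fun i => f i * g i)) -expr2; lra.
Qed.

Lemma ler_enormD x y : enorm (x + y) <= enorm x + enorm y.
Proof.
have s0 (z : 'rV[R]_k) : 0 <= \sum_i z ord0 i ^+ 2.
  by apply: sumr_ge0 => i _; exact: sqr_ge0.
rewrite -(@ler_pXn2r _ 2) ?nnegrE ?addr_ge0 ?enorm_ge0// sqrrD /enorm !sqr_sqrtr//.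
set S := \sum_i x ord0 i * y ord0 i.
have -> : \sum_i (x + y) ord0 i ^+ 2 =
    \sum_i x ord0 i ^+ 2 + S *+ 2 + \sum_i y ord0 i ^+ 2.
  by rewrite -sumrMnl -!big_split/=; apply: eq_bigr => i _; rewrite mxE sqrrD.
rewrite lerD2r lerD2l lerMn2r/= -sqrtrM//.
apply: le_trans (ler_norm S) _.
by rewrite -sqrtr_sqr ler_wsqrtr// cauchy_schwarz.
Qed.

Lemma ler_enorm_distD y x z : enorm (x - z) <= enorm (x - y) + enorm (y - z).
Proof. by apply: le_trans (ler_enormD _ _); rewrite subrKA. Qed.

End EuclideanNorm.

Section PathLength.
Context {R : realType} {k : nat}.
Implicit Types (x y u : 'rV[R]_k) (g h : R -> 'rV[R]_k) (t : R) (p : seq R) (L : set 'rV[R]_k).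

(** The sum in [path_length] in recursive form, for inductions along a partition. *)
Fixpoint chord g t p : R :=
  if p is z :: q then enorm (g z - g t) + chord g z q else 0.

Lemma chordE g t p c : \sum_(0 <= n < size p)
  enorm ((g \o nth c (t :: p)) n.+1 - (g \o nth c (t :: p)) n) = chord g t p.
Proof.
elim: p t => [|x p IH] t /=; first by rewrite big_nil.
by rewrite big_nat_recl//= -IH.
Qed.

Lemma path_lengthE g :
  path_length g = ereal_sup [set (chord g 0 p)%:E | p in itv_partition 0 1].
Proof.
by rewrite /path_length; congr ereal_sup; apply/seteqP; split => _ [p pp <-];
  exists p => //; rewrite chordE.
Qed.

Lemma chord_le_path_length g p : itv_partition 0 1 p ->
  ((chord g 0 p)%:E <= path_length g)%E.
Proof. by move=> pp; rewrite path_lengthE; apply: ereal_sup_ubound; exists p. Qed.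

Lemma path_length_le g (r : \bar R) :
  (forall p, itv_partition 0 1 p -> ((chord g 0 p)%:E <= r)%E) ->
  (path_length g <= r)%E.
Proof.
by move=> H; rewrite path_lengthE; apply: ge_ereal_sup => _ [p pp <-]; exact: H.
Qed.

Lemma path_length_ge_dist g : ((enorm (g 1 - g 0))%:E <= path_length g)%E.
Proof.
have /(chord_le_path_length g) : itv_partition (0 : R) 1 [:: 1].
  exact: itv_partition1.
by rewrite /= addr0.
Qed.

Lemma chord_comp g (f : R -> R) t p :
  chord (g \o f) t p = chord g (f t) (map f p).
Proof. by elim: p t => //= x p IH t; rewrite IH. Qed.

Lemma chord_rcons g t p z :
  chord g t (rcons p z) = chord g t p + enorm (g z - g (last t p)).
Proof. by elim: p t => [|y p IH] t /=; rewrite ?addr0 ?add0r// IH addrA. Qed.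

Lemma chord_rev g t p : chord g (last t p) (rev (belast t p)) = chord g t p.
Proof.
elim: p t => //= x p IH t; rewrite rev_cons chord_rcons IH addrC; congr (_ + _).
rewrite enorm_distC; congr (enorm (g _ - _)).
by case: p {IH} => //= y p; rewrite rev_cons last_rcons.
Qed.

Lemma chord_cst c t p : chord (fun=> c) t p = 0.
Proof. by elim: p t => //= x p IH t; rewrite subrr enorm0 IH addr0. Qed.

(** Retraction of the line onto [0, 1]. Composing with it makes a path continuous everywhere and
    changes no chord of a partition. *)
Definition clamp t : R := Num.max 0 (Num.min 1 t).

Lemma clamp_itv t : clamp t \in `[0, 1].
Proof. by rewrite in_itv/= /clamp le_max lexx/= ge_max ler01 ge_min lexx. Qed.

Lemma clamp_id t : t \in `[0, 1] -> clamp t = t.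
Proof. by rewrite in_itv/= /clamp => /andP[t0 t1]; rewrite (min_idPr t1) (max_idPr t0). Qed.

Lemma clamp_continuous : continuous clamp.
Proof.
move=> t; apply: (@continuous_max _ _ (cst 0) (fun t => Num.min 1 t)); first exact: cvg_cst.
by apply: (@continuous_min _ _ (cst 1) id); [exact: cvg_cst|exact: cvg_id].
Qed.

Lemma chord_clamp g t p : 0 <= t -> path <%R t p -> last t p <= 1 ->
  chord (g \o clamp) t p = chord g t p.
Proof.
elim: p t => //= x p IH t t0 /andP[tx xp] l1.
have x1 : x <= 1 by apply: le_trans l1; apply: (itv_partition_le (s := p)); split.
have x0 : 0 <= x by exact: le_trans (ltW tx).
rewrite IH// !clamp_id// in_itv/= ?t0 ?x0 ?x1//.
by rewrite (le_trans (ltW tx)).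
Qed.

(** Paths continuous on the whole line have the same infimum of lengths as those of [path_in], and
    free later arguments from the subspace topology. *)
Definition cpath L (x y : 'rV[R]_k) g :=
  [/\ continuous g, g 0 = x, g 1 = y & forall t, t \in `[0, 1] -> L (g t)].

Lemma cpath_path_in L x y g : cpath L x y g -> path_in L x y g.
Proof. by case=> cg g0 g1 gL; split => //; exact: continuous_subspaceT. Qed.

Lemma path_in_cpath L x y g : path_in L x y g ->
  cpath L x y (g \o clamp) /\ (path_length (g \o clamp) <= path_length g)%E.
Proof.
move=> [/subspace_continuousP cg g0 g1 gL]; split; last first.
  apply: path_length_le => p [pp /eqP pl].
  by rewrite chord_clamp ?pl//; apply: chord_le_path_length; split => //; apply/eqP.
split => [t|||t _] /=.
- apply: (@cvg_comp _ _ _ clamp g _ (within `[0, 1] (nbhs (clamp t)))); last first.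
    exact/cg/clamp_itv.
  move=> U; rewrite /within/= => UU.
  have : nbhs t (clamp @^-1` [set z | z \in `[0, 1] -> U z]).
    exact: (@clamp_continuous t _ UU).
  by apply: (@filterS _ (nbhs t)) => z; apply; exact: clamp_itv.
- by rewrite clamp_id// in_itv/= lexx ler01.
- by rewrite clamp_id// in_itv/= lexx ler01.
- exact/gL/clamp_itv.
Qed.

(* [geodesic L x y] is the real part [fine] of this infimum. *)
Definition geodE L (x y : 'rV[R]_k) : \bar R :=
  ereal_inf [set path_length g | g in path_in L x y].

Lemma geodE_le L x y g : cpath L x y g -> (geodE L x y <= path_length g)%E.
Proof.
by move=> /cpath_path_in pg; apply: ereal_inf_lbound; exists g.
Qed.

Lemma le_geodE L x y (r : \bar R) :
  (forall g, cpath L x y g -> (r <= path_length g)%E) -> (r <= geodE L x y)%E.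
Proof.
move=> H; apply: le_ereal_inf_tmp => _ [g /path_in_cpath[cg gg] <-].
exact: le_trans (H _ cg) gg.
Qed.

Lemma geodE_ge0 L x y : (0 <= geodE L x y)%E.
Proof.
apply: le_geodE => g _; apply: le_trans (path_length_ge_dist g).
by rewrite lee_fin enorm_ge0.
Qed.

Lemma geodE_ge_dist L x y : ((enorm (x - y))%:E <= geodE L x y)%E.
Proof.
apply: le_geodE => g [_ g0 g1 _]; apply: le_trans (path_length_ge_dist g).
by rewrite g0 g1 enorm_distC.
Qed.

Lemma geodExx L x : L x -> geodE L x x = 0%E.
Proof.
move=> Lx; apply/eqP; rewrite eq_le geodE_ge0 andbT.
have cx : cpath L x x (fun=> x) by split => // t; exact: cvg_cst.
apply: le_trans (geodE_le cx) _; apply: path_length_le => p _.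
by rewrite chord_cst.
Qed.

Lemma geodE_sym_le L x y : (geodE L x y <= geodE L y x)%E.
Proof.
apply: le_geodE => g [cg g0 g1 gL].
pose r (t : R) := 1 - t.
have cr : cpath L x y (g \o r).
  split => [t|||t] /=; rewrite /r ?subr0 ?subrr//; last first.
    by rewrite in_itv/= => t01; apply: gL; rewrite in_itv/=; lra.
  apply: (@continuous_comp _ _ _ r g); last exact: cg.
  by apply: (@cvgB _ R^o); [exact: cvg_cst|exact: cvg_id].
apply: le_trans (geodE_le cr) _; apply: path_length_le => p [pp /eqP pl].
rewrite chord_comp -chord_rev last_map pl.
have r1 : r 1 = 0 by rewrite /r subrr.
rewrite r1; apply: chord_le_path_length; split.
  have := rev_path <%R (r 0) (map r p); rewrite last_map pl r1 => ->.
  by rewrite path_map; apply: sub_path pp => s t /= st; rewrite /r ltrD2l ltrN2.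
case: p pp pl => [_ /= /eqP|s p _ _ /=]; first by rewrite eq_sym oner_eq0.
by rewrite rev_cons last_rcons /r subr0.
Qed.

Lemma geodE_sym L x y : geodE L x y = geodE L y x.
Proof. by apply/eqP; rewrite eq_le !geodE_sym_le. Qed.

(* The witness runs along [x, u] on [0, 1/2], then along g. *)
Lemma geodE_prepend L x u y : (forall t, t \in `[0, 1] -> L (u + t *: (x - u))) ->
  (geodE L x y <= (enorm (x - u))%:E + geodE L u y)%E.
Proof.
move=> Lxu; rewrite -leeBlDl//; apply: le_geodE => g [cg g0 g1 gL].
rewrite leeBlDl//.
have [->|] := eqVneq (path_length g) +oo%E; first by rewrite addey ?leey.
move=> goo; have gfin : path_length g \is a fin_num.
  rewrite ge0_fin_numE ?ltey// (le_trans _ (path_length_ge_dist g))//.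
  by rewrite lee_fin enorm_ge0.
pose l := fine (path_length g).
have gl : path_length g = l%:E by rewrite fineK.
have lP q : itv_partition 0 1 q -> chord g 0 q <= l.
  by move=> /(chord_le_path_length g); rewrite gl lee_fin.
(* On each half of [0, 1] one of [m] and [n] is constantly 0, so the single formula for [h]
   describes both pieces and is visibly continuous at 1/2. *)
pose m (t : R) := Num.max 0 (1 - 2 * t).
pose n (t : R) := Num.max 0 (2 * t - 1).
pose h t := m t *: (x - u) + g (n t).
have h_lo t : t <= 2^-1 -> h t = u + (1 - 2 * t) *: (x - u).
  move=> t2; rewrite /h /m /n (max_idPr _); last lra.
  by rewrite (max_idPl _) ?g0 1?addrC//; lra.
pose dbl (t : R) := 2 * t - 1.
have h_hi t : 2^-1 <= t -> h t = g (dbl t).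
  move=> t2; rewrite /dbl /h /m /n (max_idPl _); last lra.
  by rewrite scale0r add0r (max_idPr _)//; lra.
have cpn : cpath L x y h.
  split.
  - move=> t; apply: cvgD.
      apply: cvgZ; last exact: cvg_cst.
      apply: (@continuous_max _ _ (cst 0) (fun t => 1 - 2 * t)); first exact: cvg_cst.
      apply: (@cvgB _ R^o); first exact: cvg_cst.
      by apply: cvgM; [exact: cvg_cst|exact: cvg_id].
    apply: (@continuous_comp _ _ _ n g); last exact: cg.
    apply: (@continuous_max _ _ (cst 0) (fun t => 2 * t - 1)); first exact: cvg_cst.
    apply: (@cvgB _ R^o); last exact: cvg_cst.
    by apply: cvgM; [exact: cvg_cst|exact: cvg_id].
  - by rewrite h_lo ?invr_ge0// mulr0 subr0 scale1r addrC subrK.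
  - rewrite h_hi; last lra.
    by rewrite -[RHS]g1 /dbl; congr g; lra.
  - move=> t; rewrite in_itv/= => t01; case: (lerP t 2^-1) => t2.
      by rewrite h_lo//; apply: Lxu; rewrite in_itv/=; lra.
    by rewrite h_hi ?ltW//; apply: gL; rewrite in_itv/= /dbl; lra.
apply: le_trans (geodE_le cpn) _; apply: path_length_le => p [pp /eqP pl].
rewrite gl -EFinD lee_fin.
have hi t q : 2^-1 <= t -> path <%R t q ->
    chord h t q = chord g (dbl t) (map dbl q).
  elim: q t => //= z q IH t t2 /andP[tz zq].
  have z2 : 2^-1 <= z by exact: le_trans (ltW tz).
  by rewrite IH// !h_hi.
have map_path t q : path <%R t q ->
    path <%R (dbl t) (map dbl q).
  by rewrite path_map; apply: sub_path => z z' /= zz; rewrite /dbl; lra.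
have last1 t q : last t q = 1 -> last (dbl t) (map dbl q) = 1.
  by rewrite last_map => ->; rewrite /dbl; ring.
have main t q : t <= 2^-1 -> path <%R t q -> last t q = 1 ->
    chord h t q <= enorm (h t - u) + l.
  elim: q t => [t _ _ /= _|z q IH t t2 /= /andP[tz zq] zl].
    rewrite addr_ge0 ?enorm_ge0// -lee_fin -gl (le_trans _ (path_length_ge_dist g))//.
    by rewrite lee_fin enorm_ge0.
  case: (lerP z 2^-1) => z2.
    apply: le_trans (lerD (lexx _) (IH z z2 zq zl)) _.
    have E1 a b : u + a *: (x - u) - (u + b *: (x - u)) = (a - b) *: (x - u).
      by rewrite opprD addrACA subrr add0r scalerBl.
    have E2 a : u + a *: (x - u) - u = a *: (x - u) by rewrite addrAC subrr add0r.
    rewrite addrA lerD2r !h_lo// E1 !E2 !enormZ -mulrDl.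
    by rewrite ler_wpM2r ?enorm_ge0// ler0_norm ?ger0_norm; lra.
  (* The partition may jump over 1/2. The chord that does so is split at u = g 0, and its second
     half starts a partition for g, because [dbl z] is positive. *)
  apply: le_trans (lerD (ler_enorm_distD u _ _) (lexx _)) _.
  rewrite [enorm (h z - u) + _]addrC -addrA [enorm (u - _)]enorm_distC lerD2l.
  rewrite (hi _ _ (ltW z2) zq) (h_hi _ (ltW z2)) -g0.
  apply: (lP (dbl z :: _)); split => /=; last by rewrite last1.
  by rewrite map_path// andbT /dbl; lra.
apply: le_trans (main _ _ _ pp pl) _; first by rewrite invr_ge0.
by rewrite h_lo ?invr_ge0// mulr0 subr0 scale1r [u + _ - u]addrAC subrr add0r.
Qed.

(** Replacing the part before time t by a single chord cannot lengthen a path, and the part after t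
    competes in the infimum from [g t]. The times 0 and 1 are treated apart, as [t :: map f p] would
    not increase strictly there. *)
Lemma path_length_suffix L x y g t : cpath L x y g -> t \in `[0, 1] ->
  ((enorm (x - g t))%:E + geodE L (g t) y <= path_length g)%E.
Proof.
move=> [cg g0 g1 gL]; rewrite in_itv/= => /andP[]; rewrite le_eqVlt => /orP[/eqP <- _|t0].
  by rewrite g0 subrr enorm0 add0e; exact: geodE_le.
rewrite le_eqVlt => /orP[/eqP tE|t1].
  rewrite tE g1 geodExx ?adde0; last by rewrite -g1; apply: gL; rewrite in_itv/= ler01 lexx.
  by rewrite -g0 -g1 enorm_distC; exact: path_length_ge_dist.
pose f (z : R) := t + z * (1 - t).
have f0 : f 0 = t by rewrite /f mul0r addr0.
have f1 : f 1 = 1 by rewrite /f mul1r subrKC.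
have cf : cpath L (g t) y (g \o f).
  split => [z|||z] /=; rewrite ?f0 ?f1//; last first.
    rewrite in_itv/= => /andP[z0 z1]; apply: gL; rewrite in_itv/= /f.
    by apply/andP; split; nra.
  apply: (@continuous_comp _ _ _ f g); last exact: cg.
  apply: (@cvgD _ R^o); first exact: cvg_cst.
  by apply: cvgM; [exact: cvg_id|exact: cvg_cst].
apply: le_trans (leeD (lexx _) (geodE_le cf)) _.
rewrite -leeBrDl//; apply: path_length_le => p [pp /eqP pl].
rewrite leeBrDl// -EFinD chord_comp f0 -g0 enorm_distC.
apply: (@chord_le_path_length g (t :: map f p)); split => /=; last first.
  by rewrite -f0 last_map pl f1.
rewrite t0/= -[X in path _ X]f0 path_map; apply: sub_path pp => z z' /= zz.
by rewrite /f ltrD2l ltr_pM2r// subr_gt0.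
Qed.

Lemma geodE_cut L x u y :
  (forall t, t \in `[0, 1] -> L (u + t *: (x - u))) ->
  (forall g, cpath L x y g -> exists2 t, t \in `[0, 1] & g t = u) ->
  geodE L x y = ((enorm (x - u))%:E + geodE L u y)%E.
Proof.
move=> Lxu H; apply/eqP; rewrite eq_le geodE_prepend//=; apply: le_geodE => g cg.
by have [t t01 <-] := H g cg; exact: path_length_suffix.
Qed.

Lemma geodE_segment L x y : (forall t, t \in `[0, 1] -> L (y + t *: (x - y))) ->
  geodE L x y = (enorm (x - y))%:E.
Proof.
move=> Lxy; have Ly : L y.
  by have := Lxy 0; rewrite scale0r addr0; apply; rewrite in_itv/= lexx ler01.
apply/eqP; rewrite eq_le geodE_ge_dist andbT.
by have := geodE_prepend y Lxy; rewrite geodExx// adde0.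
Qed.

End PathLength.

(** * Trees *)

Section Connection.
Context {T : eqType}.
Implicit Types (e : rel T) (x y z : T).

Definition conn e x y := exists2 p, path e x p & last x p = y.

Lemma conn_refl e x : conn e x x. Proof. by exists [::]. Qed.

Lemma conn_trans e x y z : conn e x y -> conn e y z -> conn e x z.
Proof.
move=> [p ep <-] [q eq <-]; exists (p ++ q); first by rewrite cat_path ep.
by rewrite last_cat.
Qed.

Lemma conn_edge e x y : e x y -> conn e x y.
Proof. by move=> exy; exists [:: y]; rewrite //= exy. Qed.

Lemma conn_sym e x y : symmetric e -> conn e x y -> conn e y x.
Proof.
move=> se [p ep <-]; exists (rev (belast x p)).
  by rewrite rev_path; rewrite (eq_path (e' := e)).
by case: p {ep} => //= z p; rewrite rev_cons last_rcons.
Qed.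

Definition del_edge e (u v : T) : rel T := fun x y =>
  e x y && ~~ ((x == u) && (y == v) || (x == v) && (y == u)).

Lemma del_edge_sym e u v : symmetric e -> symmetric (del_edge e u v).
Proof.
by move=> se x y; rewrite /del_edge se orbC [(y == u) && _]andbC [(y == v) && _]andbC.
Qed.

(** A simple path from v to u avoiding the edge would close up with it to a cycle; having avoided
    the edge, the path has an intermediate vertex, so the cycle has at least three vertices. *)
Lemma bridge e u v : (forall c : seq T, (2 < size c)%N -> ~ ucycle e c) ->
  irreflexive e -> e u v -> ~ conn (del_edge e u v) v u.
Proof.
move=> acyc irr euv [p0 ep0]; case/shortenP: ep0 => p ep up _ l.
apply: (acyc (v :: p)).
- case: p ep up l => [_ _ /= vu|x [|y q]//= ]; first by rewrite vu irr in euv.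
  by rewrite andbT /del_edge => /andP[_ /negP H] _ xu; case: H; rewrite xu !eqxx orbT.
- apply/andP; split => //; rewrite /= rcons_path l euv andbT.
  by apply: sub_path ep => x y /andP[].
Qed.

End Connection.

Section Segments.
Context {R : realType} {k : nat}.
Implicit Types (u v w x y z : 'rV[R]_k).

Lemma segment_sym u v : segment u v = segment v u.
Proof.
suff H u' v' : segment u' v' `<=` segment v' u' by apply/seteqP; split; exact: H.
move=> _ [t t01 <-]; exists (1 - t); last by rewrite subKr addrC.
by move: t01; rewrite /= !in_itv/= subr_ge0 gerBl andbC.
Qed.

Lemma segmentl u v : segment u v u.
Proof. by exists 0; rewrite /= ?in_itv/= ?lexx ?ler01// subr0 scale1r scale0r addr0. Qed.

Lemma segmentr u v : segment u v v.
Proof. by rewrite segment_sym; exact: segmentl. Qed.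

Lemma half_open_segment_sub u v : half_open_segment u v `<=` segment u v.
Proof.
by move=> _ [t /= + <-]; rewrite in_itv/= => /andP[t0 t1]; exists t => //=;
  rewrite in_itv/= t1 ltW.
Qed.

Lemma half_open_segmentr u v : half_open_segment u v v.
Proof. by exists 1; rewrite /= ?in_itv/= ?lexx ?ltr01// subrr scale1r scale0r add0r. Qed.

Lemma segment_half_open u v x : segment u v x -> x = u \/ half_open_segment u v x.
Proof.
move=> [t /= + <-]; rewrite in_itv/= => /andP[]; rewrite le_eqVlt => /orP[/eqP <- _|t0 t1].
  by left; rewrite subr0 scale1r scale0r addr0.
by right; exists t; rewrite //= in_itv/= t0.
Qed.

Lemma segment_convex u v x y t : segment u v x -> segment u v y -> t \in `[0, 1] ->
  segment u v (y + t *: (x - y)).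
Proof.
rewrite in_itv/= => -[c + <-] [d + <-] t01; rewrite /= !in_itv/= => c01 d01.
exists (d + t * (c - d)); first by rewrite /= in_itv/=; apply/andP; split; nra.
apply/rowP => i; rewrite !mxE; ring.
Qed.

Lemma closed_segment u v : closed (segment u v).
Proof.
apply: compact_closed; first exact: norm_hausdorff.
apply: continuous_compact; last exact: segment_compact.
apply: continuous_subspaceT => t; apply: cvgD.
  apply: cvgZ; last exact: cvg_cst.
  by apply: (@cvgB _ R^o); [exact: cvg_cst|exact: cvg_id].
by apply: cvgZ; [exact: cvg_id|exact: cvg_cst].
Qed.

End Segments.

(** * Segments, endpoints and continuous paths *)

Section Network.
Context {R : realType} {k m : nat} (a b : 'I_m -> 'rV[R]_k).
Hypothesis hL : linear_network a b.
Implicit Types (u v w x y z : 'rV[R]_k) (i j : 'I_m).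

Local Notation seg i := (segment (a i) (b i)).
Local Notation endpt := (endpoint a b).
Local Notation L := (network a b).

Lemma endpoint_seg i x : endpt i x -> seg i x.
Proof. by case=> ->; [exact: segmentl|exact: segmentr]. Qed.

Lemma adj_sym : symmetric (adj a b).
Proof.
move=> u v; rewrite /adj eq_sym; congr (_ && _).
by apply: eq_existsb => i; rewrite orbC [(u == b i) && _]andbC [(u == a i) && _]andbC.
Qed.

Lemma adj_irr : irreflexive (adj a b).
Proof. by move=> u; rewrite /adj eqxx. Qed.

Lemma adj_segment u v : adj a b u v ->
  exists i, [/\ endpt i u, endpt i v, segment u v = seg i &
               forall z, endpt i z -> z = u \/ z = v].
Proof.
move=> /andP[_ /existsP[i /orP[/andP[/eqP -> /eqP ->]|/andP[/eqP -> /eqP ->]]]]; exists i;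
  split => //; rewrite /endpoint/=; [by left|by right|by right|by left| |].
- exact: segment_sym.
- by move=> z [->|->]; [right|left].
Qed.

Lemma endpoint_other i x : endpt i x ->
  exists y, [/\ endpt i y, adj a b x y & seg i = segment x y].
Proof.
have nt := segment_nontrivial hL i.
case=> ->; [exists (b i)|exists (a i)]; split; rewrite /endpoint/=; try by [left|right].
- by rewrite /adj nt/=; apply/existsP; exists i; rewrite !eqxx.
- by [].
- by rewrite /adj eq_sym nt/=; apply/existsP; exists i; rewrite !eqxx orbT.
- exact: segment_sym.
Qed.

Lemma endpoint_adj i x y : endpt i x -> endpt i y -> x != y -> adj a b x y.
Proof.
rewrite /endpoint /adj => -[->|->] [->|->] xy; rewrite ?eqxx//= in xy *; rewrite xy/=;
  by apply/existsP; exists i; rewrite !eqxx ?orbT.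
Qed.

Lemma seg_inter i j x : i != j -> seg i x -> seg j x -> endpt i x /\ endpt j x.
Proof.
move=> ij ix jx; have [E|[v [iv jv E]]] := segment_meet hL ij.
  by have : (seg i `&` seg j) x by []; rewrite E.
by have : (seg i `&` seg j) x by []; rewrite E => ->.
Qed.

(** The preimages under g of the union of the segments in I and of the union of the others are
    closed and cover [0, 1]. Both are nonempty there, so by connectedness they meet. *)
Lemma path_crossing (I : pred 'I_m) (g : R -> 'rV[R]_k) i0 j0 : continuous g ->
  (forall t, t \in `[0, 1] -> L (g t)) -> I i0 -> seg i0 (g 0) -> ~~ I j0 -> seg j0 (g 1) ->
  exists t i j, [/\ t \in `[0, 1], I i, ~~ I j, seg i (g t) & seg j (g t)].
Proof.
move=> cg gL Ii0 s0 Ij0 s1; apply: contrapT => H.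
pose U (J : pred 'I_m) := \bigcup_(i in [set i | J i]) seg i.
have cU J : closed (g @^-1` U J).
  apply: closed_comp; first by move=> x _; exact: cg.
  apply: closed_bigcup => [|i _]; [exact: finite_finset|exact: closed_segment].
have C := @segment_connected R 0 1.
have : `[0, 1]%classic `&` g @^-1` U I = `[0, 1]%classic.
  apply: C.
  - exists 0; split; last by exists i0.
    by rewrite /= in_itv/= lexx ler01.
  - exists (~` (g @^-1` U (predC I))); first exact: closed_openC.
    apply/seteqP; split => t [t01 gt]; split => //.
      move=> [j /= Ij gj]; case: gt => i Ii gi; apply: H; exists t, i, j; split => //.
    have [i _ gi] := gL _ t01; exists i => //=; apply: contrapT => /negP Ii.
    by apply: gt; exists i.
  - by exists (g @^-1` U I).
move/seteqP => [_ /(_ 1)][]; first by rewrite /= in_itv/= lexx ler01.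
move=> _ [i Ii gi]; apply: H; exists 1, i, j0; split => //.
by rewrite in_itv/= lexx ler01.
Qed.

End Network.

(** * Generations, bridges and geodesics in the tree *)

Section Tree.
Context {R : realType} {k m : nat} (a b : 'I_m -> 'rV[R]_k).
Hypotheses (hL : linear_network a b) (htree : is_tree a b).
Variable u0 : 'rV[R]_k.
Hypothesis hu0 : vertices a b u0.
Implicit Types (u v w x y z : 'rV[R]_k) (i j : 'I_m) (n p : nat).

Local Notation seg i := (segment (a i) (b i)).
Local Notation endpt := (endpoint a b).
Local Notation L := (network a b).
Local Notation gen := (generation a b u0).
Local Notation generated := (generated a b u0).
Local Notation new_edges := (new_edges a b u0).
Local Notation "e .-open" := (half_open_segment e.1 e.2)
  (at level 2, format "e .-open").

Lemma adj_vertex u v : adj a b u v -> vertices a b v.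
Proof. by move=> /adj_segment[i [_ iv _ _]]; exists i. Qed.

Lemma gen_uniq n p x : gen n x -> gen p x -> n = p.
Proof.
suff H q r : (q < r)%N -> gen q x -> ~ gen r x.
  by move=> nx px; case: (ltngtP n p) => // /H; [move=> /(_ nx)|move=> /(_ px)].
case: r => // r qr qx; rewrite generationS => -[_ + _]; apply.
by exists q.
Qed.

Lemma gen_parent n x : gen n.+1 x -> exists2 v, gen n v & adj a b x v.
Proof. by rewrite generationS => -[]. Qed.

Lemma gen_adj_le n x y : gen n x -> adj a b x y -> exists2 p, (p <= n.+1)%N & gen p y.
Proof.
move=> nx xy.
have [[p pn py]|ny] := pselect ((\bigcup_(i in `I_n.+1) gen i) y).
  by exists p => //; exact: ltnW.
exists n.+1 => //; rewrite generationS; split => //; first exact: adj_vertex xy.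
by exists x => //; rewrite adj_sym.
Qed.

(** Only topological connectedness is given. A path from the root to an unreached vertex would cross
    from a segment with reached ends to one with unreached ends, and two such segments can only meet
    in a common endpoint. *)
Lemma gen_exists x : vertices a b x -> exists n, gen n x.
Proof.
move=> xV; apply: contrapT => nx.
have step i y z : endpt i y -> endpt i z -> (exists n, gen n y) -> exists n, gen n z.
  move=> iy iz [n ny]; have [<-|yz] := eqVneq y z; first by exists n.
  by have [p _ pz] := gen_adj_le ny (endpoint_adj iy iz yz); exists p.
pose I i := `[< exists n, gen n (a i) >].
have IP i z : endpt i z -> I i <-> exists n, gen n z.
  have ia : endpt i (a i) by left.
  by move=> iz; split => [/asboolP|H]; [exact: step ia iz|apply/asboolP; exact: step iz ia H].
have [i0 _ iu0] := hu0; have [j0 _ jx] := xV.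
have Lv i z : endpt i z -> L z by move=> iz; exists i => //; exact: endpoint_seg.
have [g pg] := network_connected hL (Lv _ _ iu0) (Lv _ _ jx).
have [[cg g0 g1 gL] _] := path_in_cpath pg.
have [||||t [i [j [_ Ii Ij gi gj]]]] := path_crossing (I := I) (i0 := i0) (j0 := j0) cg gL.
- by apply/(IP _ _ iu0); exists 0%N.
- by rewrite g0; exact: endpoint_seg.
- by apply/negP => /(IP _ _ jx).
- by rewrite g1; exact: endpoint_seg.
have ij : i != j by apply: contraNneq Ij => <-.
have [iz jz] := seg_inter hL ij gi gj.
by move/negP: Ij; apply; apply/(IP _ _ jz)/(IP _ _ iz).
Qed.

(** The ancestors of x have smaller generations than J, so their chain to the root avoids v and
    hence the deleted edge. *)
Lemma conn_root n J u v x : gen n x -> (n <= J)%N -> gen J v -> x != v ->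
  conn (del_edge (adj a b) u v) x u0.
Proof.
elim: n x => [x -> _ _ _|n IH x nx nJ Jv xv]; first exact: conn_refl.
have [x' nx' xx'] := gen_parent nx.
have x'v : x' != v.
  by apply: contraTneq nJ => xE; move: nx'; rewrite xE => /(gen_uniq Jv) ->; rewrite ltnn.
apply: conn_trans (conn_edge _) (IH _ nx' (ltnW nJ) Jv x'v).
by rewrite /del_edge xx' (negbTE xv) (negbTE x'v) andbF.
Qed.

Lemma tree_bridge u v : adj a b u v -> ~ conn (del_edge (adj a b) u v) v u.
Proof. by apply: bridge => //; exact: adj_irr. Qed.

Lemma conn_del_edgeC u v x y : conn (del_edge (adj a b) u v) x y ->
  conn (del_edge (adj a b) u v) y x.
Proof. by apply: conn_sym; apply: del_edge_sym; exact: adj_sym. Qed.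

(** Otherwise the chains of ancestors of u and v, joined at the root, would connect the two ends
    without their edge. *)
Lemma gen_adj_neq n u v : gen n u -> gen n v -> adj a b u v -> False.
Proof.
case: n => [-> ->|n nu nv uv]; first by rewrite adj_irr.
have uv' : u != v by case/andP: uv.
apply: (tree_bridge uv).
have [v' nv' vv'] := gen_parent nv.
have v'u : v' != u by apply: contraTneq isT => vE; move: nu; rewrite -vE => /(gen_uniq nv') /n_Sn.
have v'v : v' != v by apply: contraTneq isT => vE; move: nv; rewrite -vE => /(gen_uniq nv') /n_Sn.
apply: (@conn_trans _ _ _ v').
  by apply: conn_edge; rewrite /del_edge vv' (negbTE v'u) (negbTE v'v) !andbF.
apply: conn_trans (conn_root u nv' (leqnSn _) nv v'v) _.
by apply: conn_del_edgeC; exact: conn_root u nu (leqnn _) nv uv'.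
Qed.

(** The generations of the two ends differ by at most one, by [gen_adj_le] in both directions, and
    they are not equal; the end of smaller generation is the source. *)
Lemma seg_new_edge i : exists n e, new_edges n e /\ seg i = segment e.1 e.2.
Proof.
have ia : endpt i (a i) by left.
have ib : endpt i (b i) by right.
have ab := endpoint_adj ia ib (segment_nontrivial hL i).
have [|n na] := @gen_exists (a i); first by exists i.
have [|p pb] := @gen_exists (b i); first by exists i.
have [q qn qb] := gen_adj_le na ab.
have [r rp ra] : exists2 r, (r <= p.+1)%N & gen r (a i).
  by apply: gen_adj_le pb _; rewrite adj_sym.
move: qn rp; rewrite (gen_uniq qb pb) (gen_uniq ra na) => pn np.
have : n != p by apply/eqP => nE; apply: (gen_adj_neq na _ ab); rewrite nE.
rewrite neq_ltn => /orP[H|H].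
- have {pn np}pE : p = n.+1 by apply/eqP; rewrite eqn_leq pn.
  by exists n, (a i, b i); split => //; split => //=; rewrite -pE.
- have {pn np}nE : n = p.+1 by apply/eqP; rewrite eqn_leq np.
  exists p, (b i, a i); split; last exact: segment_sym.
  by split => //=; rewrite -?nE// adj_sym.
Qed.

Lemma generatedS n x : generated n.+1 x <->
  generated n x \/ exists2 e, new_edges n e & e.-open x.
Proof.
split.
- move=> [->|[p /= pn [e pe ex]]]; first by left; left.
  move: pn; rewrite ltnS leq_eqVlt => /predU1P[pE|pn]; last first.
    by left; right; exists p => //; exists e.
  by right; exists e => //; rewrite -pE.
- move=> [[->|[p /= pn H]]|[e ne ex]]; first by left.
    by right; exists p => //=; rewrite ltnS ltnW.
  by right; exists n => //=; exists e.
Qed.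

Lemma generated_mono n p : (n <= p)%N -> generated n `<=` generated p.
Proof.
move=> np x [->|[q /= qn H]]; first by left.
by right; exists q => //=; exact: leq_trans np.
Qed.

Lemma gen_generated n x : gen n x -> generated n x.
Proof.
case: n => [->|n nx]; first by left.
have [v nv xv] := gen_parent nx.
apply/generatedS; right; exists (v, x); last exact: half_open_segmentr.
by split => //=; rewrite adj_sym.
Qed.

Lemma new_edge_seg n e : new_edges n e ->
  exists i, [/\ endpt i e.1, endpt i e.2, segment e.1 e.2 = seg i &
               forall z, endpt i z -> z = e.1 \/ z = e.2].
Proof. by move=> [_ _ /adj_segment]. Qed.

Lemma new_edge_segment_sub n e : new_edges n e -> segment e.1 e.2 `<=` L.
Proof. by move=> /new_edge_seg[i [_ _ -> _]] x ix; exists i. Qed.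

Lemma generated_sub n : generated n `<=` L.
Proof.
move=> x [->|[p _ [e pe /half_open_segment_sub ex]]]; last exact: new_edge_segment_sub pe _ ex.
by case: hu0 => i _ iu; exists i => //; exact: endpoint_seg.
Qed.

Lemma output_network : output a b u0 = L.
Proof.
apply/seteqP; split => [x [n _ /generated_sub//]|x [i _]].
have [n [e [ne ->]]] := seg_new_edge i.
move=> /segment_half_open[->|ex]; last first.
  by exists n.+1 => //; apply/generatedS; right; exists e.
by exists n => //; apply: gen_generated; case: ne.
Qed.

Lemma network_generated x : L x -> exists n, generated n x.
Proof. by rewrite -output_network => -[n _ nx]; exists n. Qed.

(* Deleting the edge e = (u, v), the union of u and of the segments that meet
   the component of v and the union of the other segments meet only at u. *)
Lemma new_edge_separation n e x y g : new_edges n e -> e.-open x ->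
  (generated n y \/ exists e', [/\ new_edges n e', e' <> e & e'.-open y]) ->
  cpath L x y g -> exists2 t, t \in `[0, 1] & g t = e.1.
Proof.
case: e => u v ne /half_open_segment_sub /= ux yP [cg g0 g1 gL].
have [/= nu nv uv] := ne.
have uv' : u != v by case/andP: uv.
pose T z := conn (del_edge (adj a b) u v) v z.
have Tv : T v by exact: conn_refl.
have nTu : ~ T u by exact: tree_bridge.
have rootu : conn (del_edge (adj a b) u v) u0 u.
  by apply: conn_del_edgeC; exact: conn_root u nu (leqnSn _) nv uv'.
(* Such vertices reach u through the root without the edge, so they lie outside the component [T] of
   v. *)
have nTle p z : gen p z -> (p <= n.+1)%N -> z <> v -> ~ T z.
  move=> pz pn /eqP zv Tz; apply: nTu; apply: conn_trans Tz _.
  exact: conn_trans (conn_root u pz pn nv zv) rootu.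
have Tstep z z' : adj a b z z' -> T z -> T z' \/ z = v /\ z' = u.
  move=> zz' Tz; have [H|] := boolP (del_edge (adj a b) u v z z').
    by left; apply: conn_trans Tz (conn_edge H).
  rewrite /del_edge zz'/= negbK => /orP[/andP[/eqP zE _]|/andP[/eqP -> /eqP ->]].
    by exfalso; apply: nTu; rewrite -zE.
  by right.
pose I i := `[< T (a i) \/ T (b i) >].
have IP i z : endpt i z -> T z -> I i.
  by move=> iz Tz; apply/asboolP; case: iz => <-; [left|right].
have [yE|yu] := eqVneq y u; first by exists 1; rewrite ?in_itv/= ?ler01 ?lexx ?g1.
have [i0 [i0u i0v i0E _]] := adj_segment uv.
have [j0 Ij0 j0y] : exists2 j, ~~ I j & seg j y.
  have edge_case q e' : new_edges q e' -> (q <= n)%N -> e' <> (u, v) -> e'.-open y ->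
      exists2 j, ~~ I j & seg j y.
    move=> qe qn e'e /half_open_segment_sub.
    have [j [ju jv -> jP]] := new_edge_seg qe; have [qu qv quv] := qe.
    move=> jy; exists j => //; apply/negP => /asboolP Tab.
    have nT1 : ~ T e'.1.
      apply: (nTle _ _ qu (leq_trans qn (leqnSn _))) => E.
      by move: nv qn; rewrite -E => /(gen_uniq qu) ->; rewrite ltnn.
    have nT2 : ~ T e'.2.
      apply: (nTle _ _ qv) => // E.
      move: qu quv ju nT1; rewrite E => qu quv ju nT1.
      (* The component can be left only from v to u. So if e' ended at v, its source would be u and
         e' the deleted edge. *)
      have [] := Tstep v e'.1; [by rewrite adj_sym|exact: Tv|exact: nT1|].
      by move=> [_ E1]; apply: e'e; rewrite [e']surjective_pairing E1 E.
    have nTj z : endpt j z -> ~ T z by move=> /jP[->|->].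
    by case: Tab => [/nTj|/nTj]; apply; [left|right].
  case: yP => [[yE|[q /= qn [e' qe ey]]]|[e' [ne' e'e ey]]].
  (* The root is the target of no edge. A segment through it outside [I] is the last one on a chain
     from u to the root in the graph without the edge: both of its ends are off the component of
     v. *)
  - have yn : gen 0 y by rewrite yE.
    have : conn (del_edge (adj a b) u v) u y.
      by rewrite yE; exact: conn_del_edgeC.
    move=> [p]; case: (lastP p) => [_ /= uy|p' z]; first by rewrite uy eqxx in yu.
    rewrite rcons_path last_rcons => /andP[pp' pz] zE.
    have yv : y <> v.
      by move=> E; move: nv; rewrite -E => /(gen_uniq yn).
    have nTy := nTle _ _ yn (leq0n _) yv.
    have nTl : ~ T (last u p').
      by move=> Tl; apply: nTu; apply: conn_trans Tl (conn_del_edgeC _); exists p'.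
    move: pz; rewrite zE => /andP[/adj_segment[j [jl jy jE jP]] _].
    exists j; last exact: endpoint_seg.
    have nTj w : endpt j w -> ~ T w by move=> /jP[->|->].
    by apply/negP => /asboolP[/nTj|/nTj]; apply; [left|right].
  - apply: (edge_case _ _ qe (ltnW qn) _ ey) => E.
    by move: qe; rewrite E => -[/= /(gen_uniq nu) nq _ _]; rewrite nq ltnn in qn.
  - exact: (edge_case _ _ ne' (leqnn _) e'e ey).
have Ii0 : I i0 by exact: IP i0v Tv.
have [|||t [i [j [t01 Ii Ij gi gj]]]] := path_crossing (I := I) (i0 := i0) (j0 := j0) cg gL Ii0.
- by rewrite g0 -i0E.
- exact: Ij0.
- by rewrite g1.
exists t => //.
have ij : i != j by apply: contraNneq Ij => <-.
have [iz jz] := seg_inter hL ij gi gj.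
have nTz : ~ T (g t) by move=> Tz; move/negP: Ij; apply; exact: IP jz Tz.
(* The crossing point is an endpoint of segment j, hence outside [T], while segment i has an end in
   [T]: this is the other end z. The component being left only from v to u, the crossing point is
   u. *)
have [z [iz' zadj _]] := endpoint_other hL iz.
have Tz : T z.
  have /asboolP Tab := Ii.
  have [q iq Tq] : exists2 q, endpt i q & T q.
    by case: Tab => Tq; [exists (a i)|exists (b i)] => //; [left|right].
  move: iz iz' iq Tq nTz zadj; rewrite /endpoint/= => -[->|->] [->|->] [->|->] //;
    by rewrite adj_irr.
have [] := Tstep z (g t); rewrite ?(adj_sym _ _ z)//.
by case.
Qed.

Lemma geodE_new_edge n e x y : new_edges n e -> e.-open x ->
  (generated n y \/ exists e', [/\ new_edges n e', e' <> e & e'.-open y]) ->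
  geodE L x y = ((enorm (x - e.1))%:E + geodE L e.1 y)%E.
Proof.
move=> ne ex yP; apply: geodE_cut; last first.
  by move=> g; exact: new_edge_separation ne ex yP.
move=> t t01; apply: (new_edge_segment_sub ne); apply: segment_convex => //.
- exact: half_open_segment_sub.
- exact: segmentl.
Qed.

Lemma geodE_same_edge n e x y : new_edges n e -> e.-open x -> e.-open y ->
  geodE L x y = (enorm (x - y))%:E.
Proof.
move=> ne ex ey; apply: geodE_segment => t t01; apply: (new_edge_segment_sub ne).
by apply: segment_convex => //; exact: half_open_segment_sub.
Qed.

(** [geodesic] applies [fine], which is additive only on finite values. Cutting at the sources of
    the edges reduces finiteness to the previous generation, so no connecting path has to be
    built. *)
Lemma geodE_generated_fin n x y : generated n x -> generated n y ->
  geodE L x y \is a fin_num.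
Proof.
elim: n x y => [|n IH] x y.
  move=> [->|[//]] [->|[//]]; rewrite geodExx//.
  by apply: (@generated_sub 0); left.
have src e : new_edges n e -> generated n e.1 by move=> [/gen_generated].
have old e z y' : new_edges n e -> e.-open z -> generated n y' ->
    geodE L z y' \is a fin_num.
  move=> ne ez ny'; rewrite (geodE_new_edge ne ez); last by left.
  by rewrite fin_numD/= IH//; exact: src.
move=> /generatedS[nx|[e ne ex]] /generatedS[ny|[e' ne' ey]].
- exact: IH.
- by rewrite geodE_sym; exact: old ey nx.
- exact: old ex ny.
have [ee'|ee'] := eqVneq e' e.
  by rewrite ee' in ey; rewrite (geodE_same_edge ne ex ey).
rewrite (geodE_new_edge ne ex); last by right; exists e'; split => //; apply/eqP.
by rewrite fin_numD/= geodE_sym; apply: old ey _ => //; exact: src.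
Qed.

Lemma geodesicE x y : geodesic L x y = fine (geodE L x y). Proof. by []. Qed.

Lemma geodesic_sym x y : geodesic L x y = geodesic L y x.
Proof. by rewrite !geodesicE geodE_sym. Qed.

Lemma geodesicxx x : L x -> geodesic L x x = 0.
Proof. by move=> Lx; rewrite geodesicE geodExx. Qed.

Lemma geodesic_same_edge n e x y : new_edges n e -> e.-open x -> e.-open y ->
  geodesic L x y = enorm (x - y).
Proof. by move=> ne ex ey; rewrite geodesicE (geodE_same_edge ne ex ey). Qed.

Lemma geodesic_new_edge n e x y : new_edges n e -> e.-open x ->
  (generated n y \/ exists e', [/\ new_edges n e', e' <> e & e'.-open y]) ->
  geodesic L x y = enorm (x - e.1) + geodesic L e.1 y.
Proof.
move=> ne ex yP; rewrite !geodesicE (geodE_new_edge ne ex yP) fineD//.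
have [/gen_generated nu _ _] := ne.
apply: (@geodE_generated_fin n.+1).
  by apply/generatedS; left.
by apply/generatedS; case: yP => [|[e' [ne' _ ey]]]; [left|right; exists e'].
Qed.

End Tree.

(** * The process on the tree *)

Section LinearForms.
Context d (Omega : measurableType d) (R : realType) (T : eqType).
Variable Y : T -> Omega -> R.
Implicit Types (s t : seq (R * T)) (C : T -> T -> R) (D : set T).

Definition lin s (w : Omega) : R := \sum_(q <- s) q.1 * Y q.2 w.

Definition bilin C s t : R := \sum_(q <- s) \sum_(r <- t) q.1 * r.1 * C q.2 r.2.

Lemma lin_cat s t w : lin (s ++ t) w = lin s w + lin t w.
Proof. exact: big_cat. Qed.

Lemma lin_cons q s w : lin (q :: s) w = q.1 * Y q.2 w + lin s w.
Proof. exact: big_cons. Qed.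

Lemma lin_nil w : lin [::] w = 0. Proof. exact: big_nil. Qed.

Lemma perm_lin s t : perm_eq s t -> lin s = lin t.
Proof. by move=> st; apply/funext => w; exact: perm_big. Qed.

Lemma perm_bilin C s t : perm_eq s t -> bilin C s s = bilin C t t.
Proof.
move=> st; rewrite /bilin (perm_big _ st); apply: eq_bigr => q _.
exact: perm_big.
Qed.

Lemma bilin_catl C s1 s2 t : bilin C (s1 ++ s2) t = bilin C s1 t + bilin C s2 t.
Proof. exact: big_cat. Qed.

Lemma bilin_catr C s t1 t2 : bilin C s (t1 ++ t2) = bilin C s t1 + bilin C s t2.
Proof. by rewrite /bilin -big_split; apply: eq_bigr => q _; exact: big_cat. Qed.

Lemma bilin_sym C s t : (forall x y, C x y = C y x) -> bilin C s t = bilin C t s.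
Proof.
move=> Csym; rewrite /bilin exchange_big; apply: eq_bigr => q _; apply: eq_bigr => r _.
by rewrite Csym [r.1 * _]mulrC.
Qed.

Lemma process_sigma_measurable D : (forall x, measurable_fun setT (Y x)) ->
  process_sigma Y D `<=` measurable.
Proof.
move=> mY; apply: smallest_sub; first exact: sigma_algebra_measurable.
by move=> _ [x Dx [B mB <-]]; exact: mY.
Qed.

Lemma measurable_lin s : (forall x, measurable_fun setT (Y x)) ->
  measurable_fun setT (lin s).
Proof. by move=> mY; apply: measurable_sum => q; exact: measurable_funM. Qed.

Lemma lin_process_sigma D s B : (forall q, q \in s -> D q.2) -> measurable B ->
  process_sigma Y D (lin s @^-1` B).
Proof.
move=> Ds mB.
pose G := \bigcup_(w in D) preimage_set_system setT (Y w) measurable.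
suff : measurable_fun setT (lin s : g_sigma_algebraType G -> R).
  by move=> /(_ measurableT _ mB); rewrite setTI.
elim: s Ds => [_|q s IH Ds].
  rewrite (_ : lin [::] = cst 0); first exact: measurable_cst.
  by apply/funext => w; rewrite lin_nil.
rewrite (_ : lin (q :: s) = fun w => q.1 * Y q.2 w + lin s w); last first.
  by apply/funext => w; rewrite lin_cons.
apply: measurable_funD; last by apply: IH => r rs; apply: Ds; rewrite inE rs orbT.
apply: measurable_funM => //; move=> _ A mA; apply: sub_sigma_algebra.
by exists q.2; [apply: Ds; rewrite inE eqxx|exists A].
Qed.

End LinearForms.

(** * Linear forms of the process along the construction *)

Section TreeProcess.
Context (R : realType) (k m : nat) (a b : 'I_m -> 'rV[R]_k).
Hypotheses (hL : linear_network a b) (htree : is_tree a b).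
Variables (s sigma : R).
Hypothesis hsigma : 0 < sigma.
Variables (u0 : 'rV[R]_k).
Hypothesis hu0 : vertices a b u0.
Context (d : measure_display) (Omega : measurableType d) (P : probability Omega R).
Variable Y : 'rV[R]_k -> {RV P >-> R}.
Hypothesis stepI : forall B : set R, measurable B ->
  distribution P (Y u0) B = normal_prob 0 sigma B.
Hypothesis stepII_indep : forall j : nat,
  cond_independent P (process_sigma Y (generated a b u0 j))
    (new_edges a b u0 j)
    (fun e => process_sigma Y (half_open_segment e.1 e.2)).
Hypothesis stepII_law : forall (j : nat) (u v : 'rV[R]_k),
  generation a b u0 j u -> generation a b u0 j.+1 v -> adj a b u v ->
  forall (n : nat) (w : n.-tuple 'rV[R]_k),
  (forall i : 'I_n, half_open_segment u v (tnth w i)) ->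
  exists K : R -> probability (n.-tuple R) R,
    [/\ measurable_fun [set: R] (K : R -> pprobability (n.-tuple R) R),
        is_conddist P (process_sigma Y (generated a b u0 j))
          (marginal Y w) (fun omega => K (Y u omega)) &
        {ae P, forall omega, let y := Y u omega in
          [/\ multivariate_normal (K y),
              forall i : 'I_n,
                'E_(K y)[fun x => tnth x i]%E =
                (expR (- (enorm (tnth w i - u) * s)) * y)%:E &
              forall i1 i2 : 'I_n,
                covariance (K y) (fun x => tnth x i1) (fun x => tnth x i2) =
                (sigma ^+ 2 *
                  (expR (- (enorm (tnth w i1 - tnth w i2) * s)) -
                   expR (- (enorm (tnth w i1 - u) * s)
                         - enorm (tnth w i2 - u) * s)))%:E]}].

Local Notation pt := 'rV[R]_k.
Local Notation edge := ('rV[R]_k * 'rV[R]_k)%type.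
Local Notation L := (network a b).
Local Notation gen'd := (generated a b u0).
Local Notation new_edges := (new_edges a b u0).
Local Notation "e .-open" := (half_open_segment e.1 e.2)
  (at level 2, format "e .-open").
Local Notation F j := (process_sigma Y (gen'd j)).
Local Notation lin := (lin Y).
Implicit Types (r t : seq (R * pt)) (e : edge) (l : seq edge) (B : set R) (j : nat).

Let mY x : measurable_fun setT (Y x). Proof. exact: measurable_funP. Qed.

Let mlin r : measurable_fun setT (lin r). Proof. exact: measurable_lin. Qed.

Let mlinB r B : measurable B -> measurable (lin r @^-1` B).
Proof. by move=> mB; rewrite -[X in measurable X]setTI; exact: mlin. Qed.

Let FT j : F j `<=` measurable.
Proof. exact: process_sigma_measurable. Qed.

(* For points q.2 of the edge (u, v], the linear form with coefficients q.1 has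
   conditional mean [trend u r * Y u] and conditional variance [spread u r]. *)
Definition decay (u x : pt) : R := expR (- (enorm (x - u) * s)).

Definition trend (u : pt) r : R := \sum_(q <- r) q.1 * decay u q.2.

(** The covariance along an edge of a stationary Ornstein-Uhlenbeck process given its value at u. *)
Definition bridge_cov (u x y : pt) : R := sigma ^+ 2 *
  (expR (- (enorm (x - y) * s)) - expR (- (enorm (x - u) * s) - enorm (y - u) * s)).

Definition spread (u : pt) r : R := bilin (bridge_cov u) r r.

(** The version p is taken from the kernel, so that it is nonnegative everywhere, as
    [condexp_taking_out] requires; the normal formula for it holds only almost surely. *)
Lemma edge_law j e r : new_edges j e -> (forall q, q \in r -> e.-open q.2) ->
  0 <= spread e.1 r /\ forall B, measurable B ->
  exists p, [/\ is_condprob P (F j) (lin r @^-1` B) p, forall w, 0 <= p w &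
    {ae P, forall w, (p w)%:E = gauss (trend e.1 r * Y e.1 w) (Num.sqrt (spread e.1 r)) B}].
Proof.
move=> [ju jv uv] re.
pose w : (size r).-tuple pt := [tuple of map snd (in_tuple r)].
have wE i : tnth w i = (tnth (in_tuple r) i).2 by rewrite tnth_map.
have rw i : half_open_segment e.1 e.2 (tnth w i).
  by rewrite wE; apply: re; exact: mem_tnth.
have [K [mK KF KP]] := stepII_law ju jv uv rw.
pose c i := (tnth (in_tuple r) i).1.
have linE : lin r = (fun x => \sum_i c i * tnth x i) \o marginal Y w.
  apply/funext => o; rewrite /lin big_tnth /=; apply: eq_bigr => i _.
  by rewrite /marginal tnth_mktuple wE.
have mf : measurable_fun setT (fun x : (size r).-tuple R => \sum_i c i * tnth x i).
  by apply: measurable_sum => i; apply: measurable_funM => //; exact: measurable_tnth.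
have trendE y : \sum_i c i * (expR (- (enorm (tnth w i - e.1) * s)) * y) = trend e.1 r * y.
  rewrite /trend mulr_suml [RHS]big_tnth; apply: eq_bigr => i _.
  by rewrite wE mulrA.
have spreadE : \sum_i \sum_i' c i * c i' * bridge_cov e.1 (tnth w i) (tnth w i') = spread e.1 r.
  rewrite /spread /bilin [RHS]big_tnth; apply: eq_bigr => i _.
  by rewrite [RHS]big_tnth; apply: eq_bigr => i' _; rewrite !wE.
have lawK : {ae P, forall o, 0 <= spread e.1 r /\ forall B, measurable B ->
    K (Y e.1 o) ((fun x => \sum_i c i * tnth x i) @^-1` B) =
    gauss (trend e.1 r * Y e.1 o) (Num.sqrt (spread e.1 r)) B}.
  apply: filterS KP => o /= [KN KE KC].
  have := multivariate_normal_linear KN KE KC c.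
  by rewrite trendE spreadE.
split.
  (* The inequality does not involve the outcome: if it failed, the exceptional null set would be
     the whole space. *)
  apply: contrapT => /negP sp.
  have : P setT = 0%E.
    have [N [mN PN NP]] := lawK.
    apply: (subset_measure0 (mu := P)) PN => //.
    by move=> o _; apply: NP => /= -[] /negPn; rewrite negbK; move/negP: sp.
  by rewrite probability_setT => -[/eqP]; rewrite oner_eq0.
move=> B mB; exists (fun o => fine (K (Y e.1 o) ((fun x => \sum_i c i * tnth x i) @^-1` B))).
have mfB : measurable ((fun x : (size r).-tuple R => \sum_i c i * tnth x i) @^-1` B).
  by rewrite -[X in measurable X]setTI; exact: mf.
split.
- by rewrite linE; exact: (KF _ mfB).
- by move=> o; rewrite fine_ge0.
- by apply: filterS lawK => o [_ H]; rewrite fineK ?fin_num_measure// H.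
Qed.

Definition cov (x y : pt) : R := sigma ^+ 2 * expR (- (s * geodesic L x y)).

(** Asking for some [tau] with the prescribed square makes nonnegativity of the quadratic form part
    of the induction; the sign of [tau] is immaterial. A point may occur several times in r. *)
Definition gaussian_on (D : set pt) : Prop := forall r, (forall q, q \in r -> D q.2) ->
  exists tau, tau ^+ 2 = bilin cov r r /\
    forall B, measurable B -> P (lin r @^-1` B) = gauss 0 tau B.

Lemma gaussian_on0 : gaussian_on (gen'd 0).
Proof.
move=> r r0; have {}r0 q : q \in r -> q.2 = u0 by move=> /r0[->//|[]//].
have Lu0 : L u0 by apply: (generated_sub hu0 (n := 0)); left.
pose c := \sum_(q <- r) q.1; exists (c * sigma); split.
  transitivity (c * c * sigma ^+ 2); first by ring.
  rewrite /c big_distrlr /= mulr_suml /bilin !big_seq; apply: eq_bigr => q qr.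
  rewrite mulr_suml !big_seq; apply: eq_bigr => q' qr'.
  by rewrite /cov !r0// geodesicxx// mulr0 oppr0 expR0 mulr1.
move=> B mB; rewrite -gauss_scale//.
have mcB : measurable ((fun x : R => c * x) @^-1` B).
  have mc : measurable_fun setT (fun x : R => c * x) by exact: measurable_funM.
  by rewrite -[X in measurable X]setTI; exact: mc.
rewrite [RHS](_ : _ = normal_prob 0 sigma ((fun x => c * x) @^-1` B)); last first.
  by rewrite /gauss gt_eqF.
rewrite -stepI// /distribution /pushforward; congr (P _); apply/seteqP.
have E w : lin r w = c * Y u0 w.
  by rewrite /lin /c mulr_suml !big_seq; apply: eq_bigr => q qr; rewrite r0.
by split => w /=; rewrite E.
Qed.

(** Each term goes to the first edge of l that contains its point, and to [t0] if there is none, so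
    overlaps cause no ambiguity. *)
Lemma lin_decomposition j l t : uniq l ->
  (forall q, q \in t -> gen'd j q.2 \/ exists2 e', e' \in l & e'.-open q.2) ->
  exists t0 S, [/\ forall q, q \in t0 -> gen'd j q.2,
    forall e', e' \in l -> forall q, q \in S e' -> e'.-open q.2,
    forall e', e' \notin l -> S e' = [::] &
    lin t = fun w => lin t0 w + \sum_(e' <- l) lin (S e') w].
Proof.
elim: l t => [t _ tD|f l' IH t /= /andP[fl ul'] tD].
  exists t, (fun=> [::]); split => //.
    by move=> q /tD[//|[]].
  by apply/funext => w; rewrite big_nil addr0.
pose pf (q : R * pt) := `[< f.-open q.2 >].
have [|t0 [S [t0F SP SN tE]]] := IH (seq.filter (predC pf) t) ul'.
  move=> q; rewrite mem_filter /= => /andP[/asboolPn nq /tD[|[g + gq]]]; first by left.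
  by rewrite inE => /predU1P[gf|gl]; [rewrite gf in gq|right; exists g].
exists t0, (fun g => if g == f then seq.filter pf t else S g); split => //.
- move=> g; rewrite inE => /predU1P[->|gl] q.
    by rewrite eqxx mem_filter => /andP[/asboolP].
  have -> : (g == f) = false by apply: contraNF fl => /eqP <-.
  exact: SP.
- by move=> g; rewrite inE negb_or => /andP[/negbTE -> /SN].
- have pt : perm_eq (seq.filter pf t ++ seq.filter (predC pf) t) t.
    by apply/permPl; exact: perm_filterC.
  rewrite -(perm_lin Y pt); apply/funext => w.
  rewrite lin_cat tE big_cons eqxx addrCA; congr (_ + (_ + _)).
  rewrite !big_seq; apply: eq_bigr => g gl.
  by have -> : (g == f) = false by apply: contraNF fl => /eqP <-.
Qed.

(** * Adding one edge *)

Section EdgeStep.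
Variables (j : nat) (e : edge) (l : seq edge).
Hypotheses (ne : new_edges j e) (nl : forall e', e' \in l -> new_edges j e').
Hypotheses (ul : uniq l) (el : e \notin l).

Let D (x : pt) := gen'd j x \/ exists2 e', e' \in l & e'.-open x.

Definition residual r (w : Omega) : R := lin r w - trend e.1 r * Y e.1 w.

Let mresidual r : measurable_fun setT (residual r).
Proof. by apply: measurable_funB => //; exact: measurable_funM. Qed.

Let src_F C : measurable C -> F j (Y e.1 @^-1` C).
Proof.
move=> mC; apply: sub_sigma_algebra; exists e.1; last by exists C; rewrite ?setTI.
by case: ne => /(gen_generated).
Qed.

(** By [residual_law] for P restricted to E, it suffices to know the joint law of [Y e.1] and
    [lin r] on E. Conditional independence makes the conditional probability of the edge events
    together a product; integrating it over an event of the past and taking the factor p out leaves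
    the integral of p over E, where p is a normal probability. *)
Lemma residual_cylinder (S : edge -> seq (R * pt)) r (A : set Omega) (Bs : edge -> set R) B :
  (forall q, q \in r -> e.-open q.2) ->
  (forall e', e' \in l -> forall q, q \in S e' -> e'.-open q.2) ->
  F j A -> (forall e', measurable (Bs e')) -> measurable B ->
  let E := A `&` \bigcap_(e' in [set` l]) (lin (S e') @^-1` Bs e') in
  P (E `&` residual r @^-1` B) = (P E * gauss 0 (Num.sqrt (spread e.1 r)) B)%E.
Proof.
move=> re Se FA mBs mB E.
have mA := FT FA.
set N := \bigcap_(e' in _) _ in E *.
have mN : measurable N.
  by apply: fin_bigcap_measurable => // e' _; exact: mlinB.
have mE : measurable E by exact: measurableI.
have [_ re_law] := edge_law ne re.
have Eoo : (mrestr P mE setT < +oo)%E.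
  by rewrite /mrestr ltey_eq fin_num_measure//; exact: measurableI.
have := @residual_law _ _ _ (mrestr P mE) (Y e.1) (lin r) (trend e.1 r)
  (Num.sqrt (spread e.1 r)) Eoo (mY _) (mlin r).
rewrite /= /mrestr setTI [E `&` _]setIC => -> // C B' mC mB'.
have [p [pF p0 pE]] := re_law _ mB'.
have /choice[ps psP] e' : exists p', e' \in l ->
    is_condprob P (F j) (lin (S e') @^-1` Bs e') p' /\ forall w, 0 <= p' w.
  have [e'l|] := boolP (e' \in l); last by exists (cst 0).
  have [_ /(_ _ (mBs e'))[p' [p'F p'0 _]]] := edge_law (nl e'l) (Se _ e'l).
  by exists p'.
have FA' : F j (A `&` Y e.1 @^-1` C).
  pose G := \bigcup_(w in gen'd j) preimage_set_system setT (Y w) measurable.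
  by apply: (@measurableI _ (g_sigma_algebraType G)) => //; exact: src_F.
have sigl e' : e' \in l -> process_sigma Y e'.-open (lin (S e') @^-1` Bs e').
  by move=> e'l; apply: lin_process_sigma => //; exact: Se.
have prodF : is_condprob P (F j) N (fun w => \prod_(e' <- l) ps e' w).
  apply: (stepII_indep ul nl) => e' e'l; split; first exact: sigl.
  by have [] := psP _ e'l.
have prod0 w : 0 <= \prod_(e' <- l) ps e' w.
  by rewrite big_seq; apply: prodr_ge0 => e' /psP[_].
pose El e' := if e' == e then lin r @^-1` B' else lin (S e') @^-1` Bs e'.
pose pl e' := if e' == e then p else ps e'.
have eE e' : e' \in l -> (e' == e) = false.
  by move=> e'l; apply: contraNF el => /eqP <-.
(* Conditional independence is used twice, for l alone and for e :: l; the two products differ by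
   the factor p. *)
have consF : is_condprob P (F j) (\bigcap_(e' in [set` e :: l]) El e')
    (fun w => \prod_(e' <- e :: l) pl e' w).
  apply: stepII_indep => [|e'|e'].
  - by rewrite /= el.
  - by rewrite inE => /predU1P[->//|/nl].
  - rewrite inE /El /pl => /predU1P[->|e'l].
      by rewrite eqxx; split => //; exact: lin_process_sigma.
    by rewrite (eE _ e'l); split; [exact: sigl|have [] := psP _ e'l].
have NE : \bigcap_(e' in [set` e :: l]) El e' = lin r @^-1` B' `&` N.
  apply/seteqP; split => w.
    move=> H; split; first by have := H e; rewrite /El eqxx; apply; rewrite /= inE eqxx.
    move=> e' /= e'l; have := H e'; rewrite /El (eE _ e'l); apply.
    by rewrite /= inE e'l orbT.
  move=> [H1 H2] e' /=; rewrite inE /El => /predU1P[->|e'l]; first by rewrite eqxx.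
  by rewrite (eE _ e'l); exact: H2.
have plE w : \prod_(e' <- e :: l) pl e' w = (\prod_(e' <- l) ps e' w) * p w.
  rewrite big_cons {1}/pl eqxx mulrC; congr (_ * _).
  by rewrite !big_seq; apply: eq_bigr => e' e'l; rewrite /pl eE.
have [mp _ _] := pF.
have GjT : \bigcup_(w in gen'd j) preimage_set_system setT (Y w) measurable `<=` measurable.
  by move=> _ [x Dx [B0 mB0 <-]]; exact: mY.
(* The product over l acts as the conditional probability, that of N, and p is the factor measurable
   with respect to the past. *)
have taking := condexp_taking_out GjT mN prodF prod0 mp p0 FA'.
have [_ _ consE] := consF.
have := consE _ FA'.
rewrite integral_indic; [|exact: (FT FA')|]; last first.
  by rewrite NE; apply: measurableI => //; exact: mlinB.
under eq_integral do rewrite plE.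
rewrite taking NE => H.
have VE : Y e.1 @^-1` C `&` lin r @^-1` B' `&` E = lin r @^-1` B' `&` N `&` (A `&` Y e.1 @^-1` C).
  by apply/seteqP; split => w; rewrite /E /=; tauto.
have mVC : measurable (Y e.1 @^-1` C) by rewrite -[X in measurable X]setTI; exact: mY.
have mg : measurable_fun setT (fun w => gauss (trend e.1 r * Y e.1 w) (Num.sqrt (spread e.1 r)) B').
  apply: (measurableT_comp (measurable_gauss (Num.sqrt (spread e.1 r)) mB')).
  exact: measurable_funM.
rewrite ge0_integral_mrestr//; last first.
  by move=> w; exact: measure_ge0 (gauss_prob (trend e.1 r * Y e.1 w) _) B'.
rewrite VE -H.
have -> : Y e.1 @^-1` C `&` E = A `&` Y e.1 @^-1` C `&` N.
  by apply/seteqP; split => w; rewrite /E /=; tauto.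
apply: ae_eq_integral.
- by apply: measurableI => //; apply: measurableI.
- apply: measurable_funTS; apply/measurable_EFinP => _ B0 mB0; rewrite setTI.
  exact: (FT (mp _ mB0)).
- exact: measurable_funTS.
- by apply: filterS pE => w wE _.
Qed.

(** The cylinders are stable under intersection because their defining sets intersect edge by edge,
    and t splits into forms each measurable for the sigma-algebra they generate. *)
Lemma residual_indep t r B B' : (forall q, q \in t -> D q.2) ->
  (forall q, q \in r -> e.-open q.2) -> measurable B -> measurable B' ->
  P (lin t @^-1` B `&` residual r @^-1` B') =
  (P (lin t @^-1` B) * gauss 0 (Num.sqrt (spread e.1 r)) B')%E.
Proof.
move=> tD re mB mB'.
have [t0 [S [t0F SP SN tE]]] := lin_decomposition ul tD.
pose N (Bs : edge -> set R) := \bigcap_(e' in [set` l]) (lin (S e') @^-1` Bs e').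
pose G := [set E | exists A Bs, [/\ F j A, forall e', measurable (Bs e') & E = A `&` N Bs]].
have sF : sigma_algebra setT (F j) by exact: smallest_sigma_algebra.
have FsetT : F j setT by have [F0 FC _] := sF; rewrite -(setD0 setT); exact: FC.
have NT : N (fun=> setT) = setT by apply/seteqP; split => // w _ e' _.
have GT : G `<=` measurable.
  move=> _ [A [Bs [FA mBs ->]]]; apply: measurableI; first exact: FT FA.
  by apply: fin_bigcap_measurable => // e' _; exact: mlinB.
have GI : setI_closed G.
  move=> _ _ [A1 [Bs1 [FA1 mBs1 ->]]] [A2 [Bs2 [FA2 mBs2 ->]]].
  exists (A1 `&` A2), (fun e' => Bs1 e' `&` Bs2 e'); split.
  - pose G' := \bigcup_(w in gen'd j) preimage_set_system setT (Y w) measurable.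
    exact: (@measurableI _ (g_sigma_algebraType G')).
  - by move=> e'; exact: measurableI.
  - by rewrite setIACA /N -bigcapI.
have GsetT : G setT by exists setT, (fun=> setT); rewrite NT setIT.
have mRB : measurable (residual r @^-1` B').
  by rewrite -[X in measurable X]setTI; exact: mresidual.
have PRB : P (residual r @^-1` B') = gauss 0 (Num.sqrt (spread e.1 r)) B'.
  have := residual_cylinder re SP FsetT (fun=> measurableT : measurable setT) mB'.
  by rewrite /= -/(N _) NT setIT setTI probability_setT mul1e.
rewrite -PRB; apply: (indep_pi_system GT GI GsetT mRB).
  move=> _ [A [Bs [FA mBs ->]]]; rewrite PRB.
  exact: residual_cylinder.
suff : measurable_fun setT (lin t : g_sigma_algebraType G -> R).
  by move=> /(_ measurableT _ mB); rewrite setTI.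
rewrite tE; apply: measurable_funD.
  move=> _ B0 mB0; rewrite setTI; apply: sub_sigma_algebra.
  exists (lin t0 @^-1` B0), (fun=> setT); rewrite NT setIT; split => //.
  exact: lin_process_sigma.
apply: measurable_sum => e' _ B0 mB0; rewrite setTI; apply: sub_sigma_algebra.
(* At this point e' is no longer known to belong to l. Outside l its form is empty, so the preimage
   is everything or nothing. *)
have [e'l|/SN Se'] := boolP (e' \in l); last first.
  have [B00|B00] := pselect (B0 0).
    rewrite (_ : _ @^-1` _ = setT)//; apply/seteqP; split => // w _ /=.
    by rewrite Se' lin_nil.
  exists set0, (fun=> setT); rewrite NT setIT; split => //.
    by have [] := sF.
  by apply/seteqP; split => // w /=; rewrite Se' lin_nil.
exists setT, (fun g => if g == e' then B0 else setT); split => //.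
  by move=> g; case: ifP.
rewrite setTI; apply/seteqP; split => w.
  by move=> wB g _ /=; case: eqP => // ->.
by move=> /(_ e' e'l); rewrite eqxx.
Qed.

(* With u = e.1, a form on D and the edge is a form on D, in which the part on the
   edge is replaced by its trend, plus an independent residual. *)
Lemma gaussian_on_edge : gaussian_on D -> gaussian_on (fun x => D x \/ e.-open x).
Proof.
move=> HD r rD.
pose pe (q : R * pt) := `[< e.-open q.2 >].
pose r1 := seq.filter pe r; pose r2 := seq.filter (predC pe) r.
have r1e q : q \in r1 -> e.-open q.2 by rewrite mem_filter => /andP[/asboolP].
have r2D q : q \in r2 -> D q.2.
  by rewrite mem_filter => /andP[/asboolPn nq /rD[]].
have pr : perm_eq (r1 ++ r2) r by apply/permPl; exact: perm_filterC.
pose beta := trend e.1 r1.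
have gu : gen'd j e.1 by case: ne => /gen_generated.
have tD q : q \in (beta, e.1) :: r2 -> D q.2.
  by rewrite inE => /predU1P[->|/r2D]//; left.
have [tau [tauE lawt]] := HD _ tD.
have [sp0 _] := edge_law ne r1e.
exists (Num.sqrt (tau ^+ 2 + (Num.sqrt (spread e.1 r1)) ^+ 2)); split; last first.
  move=> B mB.
  have indep A A' : measurable A -> measurable A' ->
      P (lin ((beta, e.1) :: r2) @^-1` A `&` residual r1 @^-1` A') =
      (gauss 0 tau A * gauss 0 (Num.sqrt (spread e.1 r1)) A')%E.
    by move=> mA mA'; rewrite -lawt//; exact: residual_indep.
  rewrite -(indep_gauss_sum (mlin _) (mresidual r1) indep mB); congr (P _).
  have E w : lin r w = lin ((beta, e.1) :: r2) w + residual r1 w.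
    by rewrite -(perm_lin Y pr) lin_cat lin_cons /residual /= -/beta; ring.
  by apply/seteqP; split => w /=; rewrite E.
have covC x y : cov x y = cov y x by rewrite /cov geodesic_sym.
have Lu : L e.1 by exact: (generated_sub hu0 gu).
rewrite [Num.sqrt (spread _ _) ^+ 2]sqr_sqrtr// sqr_sqrtr ?addr_ge0 ?sqr_ge0//.
rewrite tauE -(perm_bilin cov pr).
(* The distance from a point of the edge splits at e.1, and the exponential turns this sum into a
   product. *)
have E1 q q' : q \in r1 -> D q' -> cov q.2 q' = decay e.1 q.2 * cov e.1 q'.
  move=> qr q'D; rewrite /cov (geodesic_new_edge hL htree hu0 ne (r1e _ qr)).
    by rewrite mulrDr opprD expRD /decay [s * enorm _]mulrC mulrCA.
  case: q'D => [|[e' e'l ey]]; first by left.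
  by right; exists e'; split => //; [exact: nl|move=> E; move: el; rewrite -E e'l].
have B12 : bilin cov r1 r2 = beta * \sum_(q <- r2) q.1 * cov e.1 q.2.
  rewrite /bilin /beta /trend mulr_suml !big_seq; apply: eq_bigr => q qr.
  rewrite mulr_sumr !big_seq; apply: eq_bigr => q' qr'.
  by rewrite E1//; [ring|exact: r2D].
have cuu : cov e.1 e.1 = sigma ^+ 2.
  by rewrite /cov geodesicxx// mulr0 oppr0 expR0 mulr1.
(* Law of total variance on the edge: the product of decays subtracted in [bridge_cov] is restored
   by the variance of the trend, since Y has variance [sigma ^+ 2] at e.1. *)
have B11 : bilin cov r1 r1 = spread e.1 r1 + sigma ^+ 2 * beta ^+ 2.
  rewrite /spread /bilin [beta ^+ 2]expr2 /beta /trend big_distrlr /= mulr_sumr -big_split /=.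
  rewrite !big_seq; apply: eq_bigr => q qr.
  rewrite !mulr_sumr -big_split /= !big_seq; apply: eq_bigr => q' qr'.
  rewrite /cov (geodesic_same_edge ne (r1e _ qr) (r1e _ qr')) /bridge_cov /decay.
  rewrite expRD [s * _]mulrC mulrBr mulrBr.
  by set x := expR _; set y := expR _; set z := expR _; ring.
have Bu : bilin cov ((beta, e.1) :: r2) ((beta, e.1) :: r2) =
    beta ^+ 2 * sigma ^+ 2 + 2 * (beta * \sum_(q <- r2) q.1 * cov e.1 q.2) + bilin cov r2 r2.
  rewrite -[_ :: r2]cat1s bilin_catl !bilin_catr (bilin_sym r2 _ covC).
  have -> : bilin cov [:: (beta, e.1)] r2 = beta * \sum_(q <- r2) q.1 * cov e.1 q.2.
    rewrite /bilin big_seq1 mulr_sumr; apply: eq_bigr => q _ /=; ring.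
  by rewrite {1}/bilin !big_seq1 /= cuu; ring.
rewrite bilin_catl !bilin_catr (bilin_sym r2 r1 covC) B11 B12 Bu; ring.
Qed.

End EdgeStep.

Lemma gaussian_on_edges j l : uniq l -> (forall e, e \in l -> new_edges j e) ->
  gaussian_on (gen'd j) ->
  gaussian_on (fun x => gen'd j x \/ exists2 e', e' \in l & e'.-open x).
Proof.
elim: l => [_ _ H r rD|e l IH /= /andP[el ul] nl H r rD].
  by apply: H => q /rD[//|[]].
have nl' e' : e' \in l -> new_edges j e' by move=> e'l; apply: nl; rewrite inE e'l orbT.
have ne : new_edges j e by apply: nl; rewrite inE eqxx.
apply: (gaussian_on_edge ne nl' ul el (IH ul nl' H)) => q /rD[qj|[e' + qe']].
  by left; left.
rewrite inE => /predU1P[e'E|e'l]; first by right; rewrite -e'E.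
by left; right; exists e'.
Qed.

Lemma gaussian_on_generated j : gaussian_on (gen'd j).
Proof.
elim: j => [|j IH]; first exact: gaussian_on0.
move=> r rD.
(* A form involves finitely many points, so it is enough to add one edge for each new point among
   them. *)
have [l [ul nl rl]] : exists l, [/\ uniq l, forall e, e \in l -> new_edges j e &
    forall q, q \in r -> gen'd j q.2 \/ exists2 e', e' \in l & e'.-open q.2].
  elim: r rD => [_|q r IHr rD]; first by exists [::].
  have [q' q'r|l [ul nl rl]] := IHr; first by apply: rD; rewrite inE q'r orbT.
  have : gen'd j.+1 q.2 by apply: rD; rewrite inE eqxx.
  move=> /generatedS[qj|[e ne eq]].
    exists l; split => // q'; rewrite inE => /predU1P[->|/rl//]; by left.
  exists (undup (e :: l)); split; first exact: undup_uniq.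
    by move=> e'; rewrite mem_undup inE => /predU1P[->|/nl].
  move=> q'; rewrite inE => /predU1P[->|/rl[|[e' e'l e'q]]]; first 2 last.
  - by right; exists e' => //; rewrite mem_undup inE e'l orbT.
  - by right; exists e => //; rewrite mem_undup inE eqxx.
  - by left.
exact: gaussian_on_edges ul nl IH r rl.
Qed.

Lemma network_generated_tuple n (w : 'I_n -> pt) : (forall i, L (w i)) ->
  exists j, forall i, gen'd j (w i).
Proof.
move=> Lw; have /choice[f fP] i : exists j, gen'd j (w i).
  exact: (network_generated hL htree hu0).
exists (\max_i f i) => i; apply: generated_mono (fP i).
exact: leq_bigmax.
Qed.

Lemma gaussian_on_network : gaussian_on L.
Proof.
move=> r rL.
have [|j rj] := @network_generated_tuple (size r) (fun i => (tnth (in_tuple r) i).2).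
  by move=> i; apply: rL; exact: mem_tnth.
by apply: (@gaussian_on_generated j) => q /(tnthP (in_tuple r))[i ->]; exact: rj.
Qed.

Lemma network_gaussian_process : gaussian_process P L Y.
Proof.
move=> n w Lw c; pose r := [seq (c i, tnth w i) | i <- enum 'I_n].
have [|tau [_ lawr]] := gaussian_on_network (r := r).
  by move=> _ /mapP[i _ ->]; exact: Lw.
exists 0, tau => B mB; rewrite -lawr// /pushforward; congr (P _); apply/seteqP.
have E o : \sum_(i < n) c i * tnth (marginal Y w o) i = lin r o.
  rewrite /lin big_map big_enum /=; apply: eq_bigr => i _.
  by rewrite /marginal tnth_mktuple.
by split => o /=; rewrite E.
Qed.

Lemma network_law x y (c c' : R) : L x -> L y -> exists tau,
  tau ^+ 2 = c ^+ 2 * cov x x + 2 * c * c' * cov x y + c' ^+ 2 * cov y y /\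
  forall B, measurable B -> P ((fun w => c * Y x w + c' * Y y w) @^-1` B) = gauss 0 tau B.
Proof.
move=> Lx Ly.
have [|tau [tauE lawr]] := gaussian_on_network (r := [:: (c, x); (c', y)]).
  by move=> q; rewrite !inE => /orP[/eqP ->|/eqP ->].
exists tau; split.
  rewrite tauE /bilin !big_cons !big_nil /= (_ : cov y x = cov x y); first by ring.
  by rewrite /cov geodesic_sym.
move=> B mB; rewrite -lawr//; congr (P _); apply/seteqP.
have E w : lin [:: (c, x); (c', y)] w = c * Y x w + c' * Y y w.
  by rewrite !lin_cons lin_nil addr0.
by split => w /=; rewrite E.
Qed.

Let law1 x : L x -> exists tau, tau ^+ 2 = cov x x /\
  forall B, measurable B -> P (Y x @^-1` B) = gauss 0 tau B.
Proof.
move=> Lx; have [tau [tauE law]] := network_law 1 0 Lx Lx.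
exists tau; split; first by rewrite tauE; ring.
move=> B mB; rewrite -law//; congr (P _); apply/seteqP.
by split => w /=; rewrite mul1r mul0r addr0.
Qed.

Lemma network_mean x : L x -> ('E_P[Y x] = 0)%E.
Proof. by move=> /law1[tau [_ law]]; rewrite unlock (law_mean (mY x) law). Qed.

Lemma network_covariance x y : L x -> L y -> covariance P (Y x) (Y y) = (cov x y)%:E.
Proof.
move=> Lx Ly; rewrite unlock !network_mean//= unlock.
have [tx [txE lawx]] := law1 Lx; have [ty [tyE lawy]] := law1 Ly.
have [t [tE lawt]] := network_law 1 1 Lx Ly.
have mS : measurable_fun setT (fun w => 1 * Y x w + 1 * Y y w).
  by apply: measurable_funD; exact: measurable_funM.
have Ix := law_sqr_integrable (mY x) lawx; have Vx := law_sqr (mY x) lawx.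
have Iy := law_sqr_integrable (mY y) lawy; have Vy := law_sqr (mY y) lawy.
have It := law_sqr_integrable mS lawt; have Vt := law_sqr mS lawt.
(* Polarization: the product is half the square of the sum minus the two squares, and the three
   second moments are known. The differences with 0 match the form of [law_sqr]. *)
transitivity (\int[P]_w (2^-1%:E * (((1 * Y x w + 1 * Y y w - 0) ^+ 2)%:E
    - (((Y x w - 0) ^+ 2)%:E + ((Y y w - 0) ^+ 2)%:E))))%E.
  apply: eq_integral => w _.
  rewrite [LHS](_ : _ = ((Y x w - 0) * (Y y w - 0))%:E)//.
  rewrite [RHS](_ : _ = (2^-1 * ((1 * Y x w + 1 * Y y w - 0) ^+ 2
    - ((Y x w - 0) ^+ 2 + (Y y w - 0) ^+ 2)))%:E)//.
  by congr (_%:E); field.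
rewrite integralZl//; last by apply: integrableB => //; exact: integrableD.
rewrite integralB//; last exact: integrableD.
rewrite integralD// Vx Vy Vt tE txE tyE.
rewrite [LHS](_ : _ = (2^-1 * (1 ^+ 2 * cov x x + 2 * 1 * 1 * cov x y + 1 ^+ 2 * cov y y
  - (cov x x + cov y y)))%:E)//.
by congr (_%:E); field.
Qed.

End TreeProcess.

Theorem theorem4 (R : realType) (k m : nat) (a b : 'I_m -> 'rV[R]_k)
  (hL : linear_network a b) (htree : is_tree a b)
  (s sigma : R) (hs : 0 < s) (hsigma : 0 < sigma)
  (u0 : 'rV[R]_k) (hu0 : vertices a b u0)
  (d : measure_display) (Omega : measurableType d) (P : probability Omega R)
  (Y : 'rV[R]_k -> {RV P >-> R})
  (* (I) *)
  (stepI : forall B : set R, measurable B ->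
    distribution P (Y u0) B = normal_prob 0 sigma B)
  (* (II): conditional independence of the processes Y(u,v) *)
  (stepII_indep : forall j : nat,
    cond_independent P (process_sigma Y (generated a b u0 j))
      (new_edges a b u0 j)
      (fun e => process_sigma Y (half_open_segment e.1 e.2)))
  (* (II): conditional distribution of each process Y(u,v) *)
  (stepII_law : forall (j : nat) (u v : 'rV[R]_k),
    generation a b u0 j u -> generation a b u0 j.+1 v -> adj a b u v ->
    forall (n : nat) (w : n.-tuple 'rV[R]_k),
    (forall i : 'I_n, half_open_segment u v (tnth w i)) ->
    exists K : R -> probability (n.-tuple R) R,
      [/\ measurable_fun [set: R] (K : R -> pprobability (n.-tuple R) R),
          is_conddist P (process_sigma Y (generated a b u0 j))
            (marginal Y w) (fun omega => K (Y u omega)) &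
          {ae P, forall omega, let y := Y u omega in
            [/\ multivariate_normal (K y),
                forall i : 'I_n,
                  'E_(K y)[fun x => tnth x i]%E =
                  (expR (- (enorm (tnth w i - u) * s)) * y)%:E &
                forall i1 i2 : 'I_n,
                  covariance (K y) (fun x => tnth x i1) (fun x => tnth x i2) =
                  (sigma ^+ 2 *
                    (expR (- (enorm (tnth w i1 - tnth w i2) * s)) -
                     expR (- (enorm (tnth w i1 - u) * s)
                           - enorm (tnth w i2 - u) * s)))%:E]}]) :
  [/\ (* (III) *) output a b u0 = network a b,
      gaussian_process P (network a b) Y,
      forall w : 'rV[R]_k, network a b w -> 'E_P[Y w]%E = 0%E &
      forall u v : 'rV[R]_k, network a b u -> network a b v ->
        covariance P (Y u) (Y v) =
        (sigma ^+ 2 * expR (- (s * geodesic (network a b) u v)))%:E].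
Proof.
split.
- exact: output_network.
- by apply: (@network_gaussian_process _ _ _ a b _ _ s sigma _ u0 _ _ _ P Y).
- by apply: (@network_mean _ _ _ a b _ _ s sigma _ u0 _ _ _ P Y).
- by apply: (@network_covariance _ _ _ a b _ _ s sigma _ u0 _ _ _ P Y).
Qed.
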